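(* Let $\rho$ be a noncrossing equivalence relation on a finite subset $Z\subset S^1$, and let $V_k$ be the $\rho$-noncrossing equivalence classes in $Z(Z_\infty)/\rho$. The cluster category $\mathcal C_{can}(Z(Z_\infty)/\rho)$ of the cactus cyclic poset is isomorphic to the full subcategory $\mathcal C_{can}^\rho(Z(Z_\infty))$ of $\mathcal C_{can}(Z(Z_\infty))$ and, therefore, also isomorphic to the product of the cluster categories $\mathcal C_{can}(V_k)$: $$\mathcal C_{can}(Z(Z_\infty)/\rho)\cong\mathcal C_{can}^\rho(Z(Z_\infty))\cong\prod_k\mathcal C_{can}(V_k).$$
   Context: An equivalence relation $\rho$ on $Z\subset S^1$ is noncrossing if, whenever $a,b,c,d\in Z$ are in cyclic order and $a\sim_\rho c$, $b\sim_\rho d$, then $a\sim_\rho b\sim_\rho c\sim_\rho d$. For finite $Z$, with $z^+$ the next element of $Z$ counterclockwise from $z$, $$Z(Z_\infty)=\bigcup_{z\in Z}\left\{\tfrac{z^++z}2+\tfrac{z^+-z}\pi\arctan n: n\in\mathbb Z\right\}\subset S^1$$ (angles, with consecutive lifts $z<z^+$ to $\mathbb R$): a copy of $\mathbb Z$ is inserted between consecutive points of $Z$ and $Z$ itself is deleted. Two points $x,y\in Z(Z_\infty)$ are $\rho$-noncrossing if the hyperbolic geodesic $\widehat{xy}$ in the unit disk does not cross any geodesic $\widehat{ww'}$ with $w\sim_\rho w'$ in $Z$; this is an equivalence relation with finitely many classes $V_k$. A cyclic poset is a set $X$ with $c:X^3\to\mathbb N$ satisfying $c(x,y,z)-c(w,y,z)+c(w,x,z)-c(w,x,y)=0$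 and $c(x,x,y)=0=c(x,y,y)$. A subset of $S^1$ is a cyclic poset with $c(x,y,z)=1$ if $\angle(x,y)+\angle(y,z)\ge2\pi$ and $0$ otherwise, $\angle(x,y)\in[0,2\pi)$ being the counterclockwise angle from $x$ to $y$. The cactus cyclic poset $Z(Z_\infty)/\rho$ is the set $Z(Z_\infty)$ with cocycle $c_\rho(x,y,z)=c(x,y,z)+B(x,y)+B(y,z)-B(x,z)$, where $B(x,y)=0$ if $x,y$ are $\rho$-noncrossing and $B(x,y)=1$ otherwise. Each $V_k$ is a cyclic poset by restriction ($c$ and $c_\rho$ agree on $V_k$). For such a cyclic poset $X$ ($Z(Z_\infty)$, $Z(Z_\infty)/\rho$ or $V_k$), the canonical automorphism is $\varphi(x)=x^+$, the next element of $Z(Z_\infty)$ counterclockwise (it preserves each $V_k$). Let $k$ be a field, $R=k[[t]]$. $RX$ is the category with objects $P_x$ ($x\in X$), $\operatorname{Hom}(P_x,P_y)=Rf_{xy}$ free of rank one, with $f_{yz}f_{xy}=t^{c(x,y,z)}f_{xz}$ ($c$ the cocycle of $X$). $\mathcal F(X)$ is the additive category generated by all objects $E(x,y)=\left(P_x\oplus P_y,d=\begin{bmatrix}0&\beta\\ \alpha&0\end{bmatrix}\right)$ with $\alpha:P_x\to P_y$, $\beta:P_y\to P_x$ and $d^2=t$ (for given $x,y$ such objects exist only if such a factorization of $t$ exists), with morphisms the maps commuting with $d$. $\mathcal F_\varphi(X)$ is the full subcategory of objects $(P,d)$ with $d$ factoring through $\eta_P:P\to\varphi P$, $\eta_{P_x}=f_{x\varphi(x)}$;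 it is a Frobenius category with indecomposable projective-injectives $E(x,\varphi(x))$, and $\mathcal C_{can}(X)$ is its stable category. $\mathcal C_{can}^\rho(Z(Z_\infty))$ (the cactus cluster category) is the additive full subcategory of $\mathcal C_{can}(Z(Z_\infty))$ whose indecomposable objects are the $E(x,y)$ with $x,y$ $\rho$-noncrossing. *)

(* Defs.v *)
From HB Require Import structures.
From mathcomp Require Import all_boot all_order all_algebra generic_quotient.
From mathcomp Require Import ring_quotient finmap multiset zify ring lra.
From mathcomp Require Import boolp classical_sets functions reals trigo.

Set Implicit Arguments.
Unset Strict Implicit.
Unset Printing Implicit Defensive.

Import Order.TTheory GRing.Theory Num.Theory.

Local Open Scope ring_scope.

Section PowerSeries.
Variable k : fieldType.

(* k[[t]]: f stands for the series of the f n t^n. Its product is convolution, *)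
(* unlike the pointwise product available on functions.                       *)
Definition fps := nat -> k.

HB.instance Definition _ := GRing.Zmodule.on fps.

Definition fps_mul (f g : fps) : fps :=
  fun n => \sum_(i < n.+1) f i * g (n - i)%N.

Definition fps_one : fps := fun n => (n == 0%N)%:R.

Definition fps_t : fps := fun n => (n == 1%N)%:R.

Let trunc N (f : fps) : {poly k} := \poly_(i < N) f i.

Let fps_mul_trunc N f g n : (n < N)%N ->
  fps_mul f g n = (trunc N f * trunc N g)`_n.
Proof.
move=> ltnN; rewrite coefM; apply: eq_bigr => i _.
rewrite !coef_poly (leq_ltn_trans _ ltnN) ?leq_ord //.
by rewrite (leq_ltn_trans _ ltnN) ?leq_subr.
Qed.

Let fps_mul_congr n (f f' g g' : fps) :
  (forall i, (i <= n)%N -> f i = f' i) -> (forall i, (i <= n)%N -> g i = g' i) ->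
  fps_mul f g n = fps_mul f' g' n.
Proof.
move=> ff gg; apply: eq_bigr => i _.
by rewrite ff ?gg ?leq_subr // -ltnS.
Qed.

Fact fps_mulA : associative fps_mul.
Proof.
move=> f g h; apply/funext => n.
pose T := trunc n.+1.
have coefT p i : (i <= n)%N -> (T (fun j => p`_j))`_i = p`_i :> k.
  by move=> lein; rewrite coef_poly ltnS lein.
have Tc f' i : (i <= n)%N -> f' i = (T f')`_i.
  by move=> lein; rewrite coef_poly ltnS lein.
rewrite (@fps_mul_congr n f f _ (fun i => (T g * T h)`_i)) //; last first.
  by move=> i lein; rewrite (@fps_mul_trunc n.+1).
rewrite (@fps_mul_congr n (fps_mul f g) (fun i => (T f * T g)`_i) h h) //; last first.
  by move=> i lein; rewrite (@fps_mul_trunc n.+1).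
rewrite /fps_mul.
transitivity (T f * (T g * T h))`_n.
  by rewrite coefM; apply: eq_bigr => i _; rewrite -Tc // -ltnS.
rewrite mulrA coefM; apply: eq_bigr => i _.
by rewrite -Tc ?leq_subr.
Qed.

Fact fps_mulC : commutative fps_mul.
Proof.
by move=> f g; apply/funext => n; rewrite !(@fps_mul_trunc n.+1) // mulrC.
Qed.

Fact fps_mul1 : left_id fps_one fps_mul.
Proof.
move=> f; apply/funext => n; rewrite /fps_mul big_ord_recl subn0 mul1r.
by rewrite big1 ?addr0 // => i _; rewrite mul0r.
Qed.

Fact fps_mulDl : left_distributive fps_mul +%R.
Proof.
move=> f g h; apply/funext => n; rewrite /fps_mul.
rewrite (_ : (_ + _ : fps) n = \sum_(i < n.+1) f i * h (n - i)%N +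
  \sum_(i < n.+1) g i * h (n - i)%N) // -big_split /=.
by apply: eq_bigr => i _; rewrite -mulrDl.
Qed.

Fact fps_one_neq0 : fps_one != 0.
Proof. by apply/eqP => /(congr1 (@^~ 0%N))/eqP; rewrite oner_eq0. Qed.

HB.instance Definition _ := GRing.Zmodule_isComNzRing.Build fps
  fps_mulA fps_mulC fps_mul1 fps_mulDl fps_one_neq0.

End PowerSeries.

Arguments fps_t {k}.

Section DepProduct.
Variables (A : comNzRingType) (I : Type) (V : I -> lmodType A).

Definition dprod := forall i, V i.

HB.instance Definition _ := Choice.on dprod.

Let add (f g : dprod) : dprod := fun i => f i + g i.
Let opp (f : dprod) : dprod := fun i => - f i.
Let zero : dprod := fun i => 0.
Let scale (a : A) (f : dprod) : dprod := fun i => a *: f i.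

Fact dprod_addA : associative add.
Proof. by move=> f g h; apply/functional_extensionality_dep => i; exact: addrA. Qed.
Fact dprod_addC : commutative add.
Proof. by move=> f g; apply/functional_extensionality_dep => i; exact: addrC. Qed.
Fact dprod_add0 : left_id zero add.
Proof. by move=> f; apply/functional_extensionality_dep => i; exact: add0r. Qed.
Fact dprod_addN : left_inverse zero opp add.
Proof. by move=> f; apply/functional_extensionality_dep => i; exact: addNr. Qed.

HB.instance Definition _ := GRing.isZmodule.Build dprod
  dprod_addA dprod_addC dprod_add0 dprod_addN.

Fact dprod_scaleA a b (f : dprod) : scale a (scale b f) = scale (a * b) f.
Proof. by apply/functional_extensionality_dep => i; exact: scalerA. Qed.
Fact dprod_scale1 : left_id 1 scale.
Proof. by move=> f; apply/functional_extensionality_dep => i; exact: scale1r. Qed.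
Fact dprod_scaleDr : right_distributive scale +%R.
Proof. by move=> a f g; apply/functional_extensionality_dep => i; exact: scalerDr. Qed.
Fact dprod_scaleDl f : {morph scale^~ f : a b / a + b}.
Proof. by move=> a b; apply/functional_extensionality_dep => i; exact: scalerDl. Qed.

HB.instance Definition _ := GRing.Zmodule_isLmodule.Build A dprod
  dprod_scaleA dprod_scale1 dprod_scaleDr dprod_scaleDl.

End DepProduct.

Section QuotientModule.
Variables (A : comNzRingType) (V : lmodType A).
Variables (N : {pred V}) (subN : submod_closed N).
Local Open Scope quotient_scope.

Definition submod_pred of submod_closed N : {pred V} := N.

HB.instance Definition _ :=
  GRing.isSubmodClosed.Build A V (submod_pred subN) subN.
HB.instance Definition _ :=
  GRing.isZmodClosed.Build V (submod_pred subN) (GRing.submod_closedB subN).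

Lemma submod_predD u v : u \in N -> v \in N -> u + v \in N.
Proof. exact: (@rpredD _ (submod_pred subN)). Qed.

Definition quotmod := Quotient.quot (submod_pred subN).

HB.instance Definition _ := GRing.Zmodule.on quotmod.

Definition qclass (v : V) : quotmod := \pi_(Quotient.quot (submod_pred subN)) v.
Definition qrepr (q : quotmod) : V := repr (q : Quotient.quot (submod_pred subN)).

Lemma qreprK : cancel qrepr qclass.
Proof. by move=> q; exact: reprK. Qed.

Lemma qclassP u v : reflect (qclass u = qclass v) (u - v \in N).
Proof. by rewrite -[N]/(submod_pred subN : {pred V}) Quotient.idealrBE; exact: eqP. Qed.

Lemma qreprP v : qrepr (qclass v) - v \in N.
Proof. by apply/qclassP; rewrite qreprK. Qed.

Lemma qclassD u v : qclass (u + v) = qclass u + qclass v.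
Proof. exact: Quotient.pi_add. Qed.

Let scale (a : A) (q : quotmod) : quotmod := qclass (a *: qrepr q).

Let qclassZ' a v : qclass (a *: v) = scale a (qclass v).
Proof. by apply/esym/qclassP; rewrite -scalerBr (@rpredZ _ _ (submod_pred subN)) // qreprP. Qed.

Fact quotmod_scaleA a b q : scale a (scale b q) = scale (a * b) q.
Proof. by rewrite -[q]qreprK -!qclassZ' scalerA. Qed.
Fact quotmod_scale1 : left_id 1 scale.
Proof. by move=> q; rewrite -[q]qreprK -!qclassZ' scale1r. Qed.
Fact quotmod_scaleDr : right_distributive scale +%R.
Proof.
move=> a p q; rewrite -[p]qreprK -[q]qreprK -qclassD -!qclassZ'.
by rewrite scalerDr qclassD.
Qed.
Fact quotmod_scaleDl q : {morph scale^~ q : a b / a + b}.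
Proof. by move=> a b; rewrite -[q]qreprK -!qclassZ' scalerDl qclassD. Qed.

HB.instance Definition _ := GRing.Zmodule_isLmodule.Build A quotmod
  quotmod_scaleA quotmod_scale1 quotmod_scaleDr quotmod_scaleDl.

Lemma qclassZ a v : qclass (a *: v) = a *: qclass v.
Proof. exact: qclassZ'. Qed.

End QuotientModule.

Arguments qclass {A V N} subN v.

Section LinearCategories.
Variable A : comNzRingType.

Record lincat := LinCat {
  ob : Type;
  mor : ob -> ob -> lmodType A;
  hcomp : forall x y z, mor y z -> mor x y -> mor x z;
  idm : forall x, mor x x;
  compA : forall x y z u (h : mor z u) (g : mor y z) (f : mor x y),
    hcomp h (hcomp g f) = hcomp (hcomp h g) f;
  comp1m : forall x y (f : mor x y), hcomp (idm y) f = f;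
  compm1 : forall x y (f : mor x y), hcomp f (idm x) = f;
  comp_linr : forall x y z (g : mor y z) a (f f' : mor x y),
    hcomp g (a *: f + f') = a *: hcomp g f + hcomp g f';
  comp_linl : forall x y z (f : mor x y) a (g g' : mor y z),
    hcomp (a *: g + g') f = a *: hcomp g f + hcomp g' f
}.

Record linfunctor (C D : lincat) := LinFunctor {
  fob : ob C -> ob D;
  fhom : forall x y, mor x y -> mor (fob x) (fob y);
  fhom_id : forall x, fhom (idm x) = idm (fob x);
  fhom_comp : forall x y z (g : mor y z) (f : mor x y),
    fhom (hcomp g f) = hcomp (fhom g) (fhom f);
  fhom_lin : forall x y a (f f' : mor x y),
    fhom (a *: f + f') = a *: fhom f + fhom f'
}.

Definition lincat_iso (C D : lincat) : Prop :=
  exists F : linfunctor C D,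
    bijective (fob F) /\ forall x y, bijective (@fhom _ _ F x y).

Definition fullcat (C : lincat) (T : Type) (o : T -> ob C) : lincat :=
  @LinCat T (fun x y => mor (o x) (o y)) (fun x y z g f => hcomp g f)
    (fun x => idm (o x)) (fun x y z u => @compA C _ _ _ _)
    (fun x y => @comp1m C _ _) (fun x y => @compm1 C _ _)
    (fun x y z => @comp_linr C _ _ _) (fun x y z => @comp_linl C _ _ _).

Section ProductCategory.
Variables (K : Type) (C : K -> lincat).

Definition prod_hom (x y : forall i, ob (C i)) : lmodType A :=
  dprod (fun i => mor (x i) (y i)).

Definition prod_comp x y z (g : prod_hom y z) (f : prod_hom x y) :
  prod_hom x z := fun i => hcomp (g i) (f i).

Definition prod_id x : prod_hom x x := fun i => idm (x i).

Fact prod_compA x y z u (h : prod_hom z u) (g : prod_hom y z)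
    (f : prod_hom x y) :
  prod_comp h (prod_comp g f) = prod_comp (prod_comp h g) f.
Proof. by apply/functional_extensionality_dep => i; exact: compA. Qed.
Fact prod_comp1m x y (f : prod_hom x y) : prod_comp (@prod_id y) f = f.
Proof. by apply/functional_extensionality_dep => i; exact: comp1m. Qed.
Fact prod_compm1 x y (f : prod_hom x y) : prod_comp f (@prod_id x) = f.
Proof. by apply/functional_extensionality_dep => i; exact: compm1. Qed.
Fact prod_comp_linr x y z (g : prod_hom y z) a (f f' : prod_hom x y) :
  prod_comp g (a *: f + f') = a *: prod_comp g f + prod_comp g f'.
Proof. by apply/functional_extensionality_dep => i; exact: comp_linr. Qed.
Fact prod_comp_linl x y z (f : prod_hom x y) a (g g' : prod_hom y z) :
  prod_comp (a *: g + g') f = a *: prod_comp g f + prod_comp g' f.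
Proof. by apply/functional_extensionality_dep => i; exact: comp_linl. Qed.

Definition prodcat : lincat :=
  LinCat prod_compA prod_comp1m prod_compm1 prod_comp_linr prod_comp_linl.

End ProductCategory.

Record catideal (C : lincat) := CatIdeal {
  nul : forall x y : ob C, {pred @mor C x y};
  nul_submod : forall x y, submod_closed (@nul x y);
  nul_compl : forall x y z (g : mor y z) (f : mor x y),
    f \in @nul x y -> hcomp g f \in @nul x z;
  nul_compr : forall x y z (g : mor y z) (f : mor x y),
    g \in @nul y z -> hcomp g f \in @nul x z
}.

Section QuotientCategory.
Variables (C : lincat) (N : catideal C).

Definition quot_hom (x y : ob C) : lmodType A := quotmod (nul_submod N x y).

Definition quot_comp (x y z : ob C) (g : quot_hom y z) (f : quot_hom x y) :
  quot_hom x z := qclass (nul_submod N x z) (hcomp (qrepr g) (qrepr f)).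

Definition quot_id (x : ob C) : quot_hom x x :=
  qclass (nul_submod N x x) (idm x).

Lemma comp_subr x y z (g : @mor C y z) (f f' : mor x y) :
  hcomp g (f - f') = hcomp g f - hcomp g f'.
Proof. by rewrite addrC -scaleN1r comp_linr scaleN1r addrC. Qed.

Lemma comp_subl x y z (f : @mor C x y) (g g' : mor y z) :
  hcomp (g - g') f = hcomp g f - hcomp g' f.
Proof. by rewrite addrC -scaleN1r comp_linl scaleN1r addrC. Qed.

Lemma quot_compE x y z (g : mor y z) (f : mor x y) :
  quot_comp (qclass _ g : quot_hom y z) (qclass _ f : quot_hom x y) =
  qclass _ (hcomp g f).
Proof.
apply/qclassP; set g' := qrepr _; set f' := qrepr _.
rewrite -[X in X - _](subrK (hcomp g f')) -addrA -comp_subl -comp_subr.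
apply: (submod_predD (nul_submod N x z)).
  by rewrite nul_compr // qreprP.
by rewrite nul_compl // qreprP.
Qed.

Fact quot_compA x y z u (h : quot_hom z u) (g : quot_hom y z)
    (f : quot_hom x y) :
  quot_comp h (quot_comp g f) = quot_comp (quot_comp h g) f.
Proof.
by rewrite -[h]qreprK -[g]qreprK -[f]qreprK !quot_compE compA.
Qed.
Fact quot_comp1m x y (f : quot_hom x y) : quot_comp (@quot_id y) f = f.
Proof. by rewrite -[f]qreprK quot_compE comp1m. Qed.
Fact quot_compm1 x y (f : quot_hom x y) : quot_comp f (@quot_id x) = f.
Proof. by rewrite -[f]qreprK quot_compE compm1. Qed.
Fact quot_comp_linr x y z (g : quot_hom y z) a (f f' : quot_hom x y) :
  quot_comp g (a *: f + f') = a *: quot_comp g f + quot_comp g f'.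
Proof.
rewrite -[g]qreprK -[f]qreprK -[f']qreprK -qclassZ -qclassD !quot_compE.
by rewrite comp_linr qclassD qclassZ.
Qed.
Fact quot_comp_linl x y z (f : quot_hom x y) a (g g' : quot_hom y z) :
  quot_comp (a *: g + g') f = a *: quot_comp g f + quot_comp g' f.
Proof.
rewrite -[f]qreprK -[g]qreprK -[g']qreprK -qclassZ -qclassD !quot_compE.
by rewrite comp_linl qclassD qclassZ.
Qed.

Definition quotcat : lincat :=
  LinCat quot_compA quot_comp1m quot_compm1 quot_comp_linr quot_comp_linl.

End QuotientCategory.

(* Pairs (P, d) with d^2 = t, and morphisms commuting with d. *)
Section DifferentialObjects.
Variables (C : lincat) (t : A).

Record dob := DOb {
  dobj :> ob C;
  ddiff : mor dobj dobj;
  diff2 : hcomp ddiff ddiff = t *: idm dobj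
}.

Definition commdiff (M N : dob) : {pred @mor C M N} :=
  [pred f | hcomp (ddiff N) f == hcomp f (ddiff M)].

Fact commdiff_submod M N : submod_closed (@commdiff M N).
Proof.
have comp0 x y z (g : @mor C y z) : hcomp g (0 : mor x y) = 0.
  by rewrite -(subrr 0) comp_subr subrr.
have compr0 x y z (f : @mor C x y) : hcomp (0 : mor y z) f = 0.
  by rewrite -(subrr 0) comp_subl subrr.
split; first by rewrite inE comp0 compr0.
move=> a f g; rewrite !inE => /eqP fd /eqP gd.
by rewrite comp_linr comp_linl fd gd.
Qed.

HB.instance Definition _ (M N : dob) :=
  GRing.isSubmodClosed.Build A (@mor C M N) (@commdiff M N)
    (@commdiff_submod M N).

Record dhom (M N : dob) := DHom {
  dhomval :> @mor C M N;
  dhomP : dhomval \in @commdiff M N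
}.

HB.instance Definition _ (M N : dob) := [isSub for @dhomval M N].
HB.instance Definition _ (M N : dob) := [Choice of dhom M N by <:].
HB.instance Definition _ (M N : dob) := [SubChoice_isSubLmodule of dhom M N by <:].

Lemma commdiffP (M N : dob) (f : @mor C M N) :
  reflect (hcomp (ddiff N) f = hcomp f (ddiff M)) (f \in @commdiff M N).
Proof. exact: eqP. Qed.

Lemma dhomE (M N : dob) (f : dhom M N) : hcomp (ddiff N) f = hcomp f (ddiff M).
Proof. exact/commdiffP/dhomP. Qed.

Fact dcomp_subproof (M N P : dob) (g : dhom N P) (f : dhom M N) :
  hcomp g f \in @commdiff M P.
Proof.
move/eqP: (dhomP g) => gd; move/eqP: (dhomP f) => fd.
by rewrite inE compA gd -compA fd compA.
Qed.

Fact did_subproof (M : dob) : idm M \in @commdiff M M.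
Proof. by rewrite inE comp1m compm1. Qed.

Definition dcomp (M N P : dob) (g : dhom N P) (f : dhom M N) : dhom M P :=
  DHom (dcomp_subproof g f).

Definition did (M : dob) : dhom M M := DHom (did_subproof M).

Fact dcompA M N P Q (h : dhom P Q) (g : dhom N P) (f : dhom M N) :
  dcomp h (dcomp g f) = dcomp (dcomp h g) f.
Proof. by apply/val_inj; exact: compA. Qed.
Fact dcomp1m M N (f : dhom M N) : dcomp (did N) f = f.
Proof. by apply/val_inj; exact: comp1m. Qed.
Fact dcompm1 M N (f : dhom M N) : dcomp f (did M) = f.
Proof. by apply/val_inj; exact: compm1. Qed.
Fact dcomp_linr M N P (g : dhom N P) a (f f' : dhom M N) :
  dcomp g (a *: f + f') = a *: dcomp g f + dcomp g f'.
Proof. by apply/val_inj; exact: comp_linr. Qed.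
Fact dcomp_linl M N P (f : dhom M N) a (g g' : dhom N P) :
  dcomp (a *: g + g') f = a *: dcomp g f + dcomp g' f.
Proof. by apply/val_inj; exact: comp_linl. Qed.

Definition dcat : lincat :=
  @LinCat dob (fun M N => dhom M N) dcomp did
    dcompA dcomp1m dcompm1 dcomp_linr dcomp_linl.

End DifferentialObjects.

End LinearCategories.

Arguments hcomp {A l x y z}.
Arguments idm {A l}.

Record cyclicPoset := CyclicPoset {
  cpoint :> Type;
  cocycle : cpoint -> cpoint -> cpoint -> nat;
  cocycle_eq : forall x y z w,
    (cocycle x y z)%:Z - (cocycle w y z)%:Z + (cocycle w x z)%:Z
      - (cocycle w x y)%:Z = 0;
  cocyclexxy : forall x y, cocycle x x y = 0%N;
  cocyclexyy : forall x y, cocycle x y y = 0%N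
}.

Definition subposet (X : cyclicPoset) (V : set X) : cyclicPoset :=
  @CyclicPoset (set_type V)
    (fun x y z => cocycle (val x) (val y) (val z))
    (fun x y z w => cocycle_eq (val x) (val y) (val z) (val w))
    (fun x y => cocyclexxy (val x) (val y))
    (fun x y => cocyclexyy (val x) (val y)).

(* The restriction of phi to V; only meaningful when phi maps V to V, in which *)
(* case the default value of insubd is never used.                            *)
Definition subauto (X : cyclicPoset) (phi : X -> X) (V : set X) :
    subposet V -> subposet V :=
  fun x => insubd (x : set_type V) (phi (val x)).

Section ClusterCategory.
Variables (k : fieldType) (X : cyclicPoset) (phi : X -> X).
Local Notation A := (fps k).

Lemma cocycleA (x y z u : X) :
  (cocycle y z u + cocycle x y u)%N = (cocycle x z u + cocycle x y z)%N.
Proof. have := cocycle_eq y z u x; lia. Qed.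

(* A morphism P_x -> P_y is r f_xy, represented by r. *)
Definition RX_comp (x y z : X) (b a : A^o) : A^o :=
  b * a * fps_t ^+ cocycle x y z.

Fact RX_compA x y z u h g f :
  RX_comp x z u h (RX_comp x y z g f) = RX_comp x y u (RX_comp y z u h g) f.
Proof.
rewrite /RX_comp; have := cocycleA x y z u; set p := cocycle _ _ _ => e.
transitivity (h * g * f * fps_t ^+ (cocycle x z u + cocycle x y z)%N : A).
  by rewrite exprD; ring.
by rewrite -e exprD; ring.
Qed.
Fact RX_comp1m x y f : RX_comp x y y 1 f = f.
Proof. by rewrite /RX_comp cocyclexyy mul1r mulr1. Qed.
Fact RX_compm1 x y f : RX_comp x x y f 1 = f.
Proof. by rewrite /RX_comp cocyclexxy !mulr1. Qed.
Fact RX_comp_linr x y z g (a : A) f f' :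
  RX_comp x y z g (a *: f + f') = a *: RX_comp x y z g f + RX_comp x y z g f'.
Proof. by rewrite /RX_comp /GRing.scale /=; ring. Qed.
Fact RX_comp_linl x y z f (a : A) g g' :
  RX_comp x y z (a *: g + g') f = a *: RX_comp x y z g f + RX_comp x y z g' f.
Proof. by rewrite /RX_comp /GRing.scale /=; ring. Qed.

Definition RX : lincat A :=
  @LinCat _ X (fun _ _ => A^o) RX_comp (fun _ => 1)
    RX_compA RX_comp1m RX_compm1 RX_comp_linr RX_comp_linl.

(* Objects of addRX are finite direct sums of P_x's, morphisms are matrices. *)
Record family := Family { idx : finType; pts : idx -> X }.

Definition family_hom (P Q : family) : lmodType A := idx Q -> idx P -> A^o.

Definition family_comp (P Q S : family) (g : family_hom Q S)
    (f : family_hom P Q) : family_hom P S :=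
  fun s p => \sum_(q : idx Q)
    @hcomp _ RX (pts p) (pts q) (pts s) (g s q) (f q p).

Definition family_id (P : family) : family_hom P P := fun i j => (i == j)%:R.

Let comp_suml x y z (f : @mor _ RX x y) (I : finType) (g : I -> mor y z) :
  hcomp (\sum_i g i) f = \sum_i hcomp (g i) f.
Proof. by rewrite /= /RX_comp !mulr_suml. Qed.

Let comp_sumr x y z (g : @mor _ RX y z) (I : finType) (f : I -> mor x y) :
  hcomp g (\sum_i f i) = \sum_i hcomp g (f i).
Proof. by rewrite /= /RX_comp mulr_sumr mulr_suml. Qed.

Fact family_compA P Q S T (h : family_hom S T) (g : family_hom Q S)
    (f : family_hom P Q) :
  family_comp h (family_comp g f) = family_comp (family_comp h g) f.
Proof.
apply/funext => t; apply/funext => p; rewrite /family_comp.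
under eq_bigr do rewrite comp_sumr.
rewrite exchange_big /=; apply: eq_bigr => q _.
rewrite [RHS]comp_suml; apply: eq_bigr => s _; exact: (@compA _ RX).
Qed.
Fact family_comp1m P Q (f : family_hom P Q) : family_comp (@family_id Q) f = f.
Proof.
apply/funext => q; apply/funext => p; rewrite /family_comp /family_id.
rewrite (bigD1 q) //= big1 ?addr0 => [|i /negPf ni]; rewrite /RX_comp.
  by rewrite eqxx cocyclexyy mul1r mulr1.
by rewrite eq_sym ni !mul0r.
Qed.
Fact family_compm1 P Q (f : family_hom P Q) : family_comp f (@family_id P) = f.
Proof.
apply/funext => q; apply/funext => p; rewrite /family_comp /family_id.
rewrite (bigD1 p) //= big1 ?addr0 => [|i /negPf ni]; rewrite /RX_comp.
  by rewrite eqxx cocyclexxy !mulr1.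
by rewrite ni mulr0 mul0r.
Qed.
Fact family_comp_linr P Q S (g : family_hom Q S) a (f f' : family_hom P Q) :
  family_comp g (a *: f + f') = a *: family_comp g f + family_comp g f'.
Proof.
apply/funext => s; apply/funext => p.
transitivity (a *: (\sum_q @hcomp _ RX (pts p) (pts q) (pts s) (g s q) (f q p)) +
  \sum_q @hcomp _ RX (pts p) (pts q) (pts s) (g s q) (f' q p)); last by [].
rewrite scaler_sumr -big_split; apply: eq_bigr => q _.
exact: (@comp_linr _ RX).
Qed.
Fact family_comp_linl P Q S (f : family_hom P Q) a (g g' : family_hom Q S) :
  family_comp (a *: g + g') f = a *: family_comp g f + family_comp g' f.
Proof.
apply/funext => s; apply/funext => p.
transitivity (a *: (\sum_q @hcomp _ RX (pts p) (pts q) (pts s) (g s q) (f q p)) +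
  \sum_q @hcomp _ RX (pts p) (pts q) (pts s) (g' s q) (f q p)); last by [].
rewrite scaler_sumr -big_split; apply: eq_bigr => q _.
exact: (@comp_linl _ RX).
Qed.

Definition addRX : lincat A :=
  LinCat family_compA family_comp1m family_compm1
    family_comp_linr family_comp_linl.

Lemma hom_addRXP (P Q : family) (f g : @mor _ addRX P Q) :
  (forall q p, f q p = g q p) -> f = g.
Proof. by move=> fg; apply/funext => q; apply/funext => p. Qed.

Lemma comp_addRXE (P Q S : family) (g : @mor _ addRX Q S)
    (f : @mor _ addRX P Q) s p :
  hcomp g f s p =
    \sum_(q : idx Q) g s q * f q p * fps_t ^+ cocycle (pts p) (pts q) (pts s).
Proof. by []. Qed.

Definition phiob (P : family) : family := Family (fun i : idx P => phi (pts i)).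

Definition eta (P : family) : @mor _ addRX P (phiob P) :=
  fun i j => (i == j)%:R.

(* The data of an object E(x, y), with alpha : P_x -> P_y, beta : P_y -> P_x. *)
Record edata := EData {
  ex : X;
  ey : X;
  ealpha : @mor _ RX ex ey;
  ebeta : @mor _ RX ey ex;
  ebetaalpha : hcomp ebeta ealpha = fps_t *: @idm _ RX ex;
  ealphabeta : hcomp ealpha ebeta = fps_t *: @idm _ RX ey
}.

HB.instance Definition _ := gen_eqMixin edata.
HB.instance Definition _ := gen_choiceMixin edata.

Section DirectSum.
Variables (I : finType) (e : I -> edata).

Definition sumE_family : family :=
  @Family (I * bool)%type
    (fun u => if u.2 then ey (e u.1) else ex (e u.1)).

Definition sumE_diff : @mor _ addRX sumE_family sumE_family :=
  fun v u => if v.1 == u.1 then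
    match u.2, v.2 with
    | false, true => ealpha (e u.1)
    | true, false => ebeta (e u.1)
    | _, _ => 0
    end else 0.

Fact sumE_diff2 :
  hcomp sumE_diff sumE_diff = fps_t *: @idm _ addRX sumE_family.
Proof.
apply/funext => -[i b]; apply/funext => -[j c].
transitivity (\sum_u @hcomp _ RX (@pts sumE_family (j, c)) (@pts sumE_family u)
  (@pts sumE_family (i, b)) (sumE_diff (i, b) u) (sumE_diff u (j, c))) => //.
rewrite (bigD1 (j, ~~ c)) //= [X in _ + X]big1 ?addr0; last first.
  move=> [l d] /negPf; rewrite xpair_eqE /RX_comp /sumE_diff /=.
  have [->|_] := eqVneq l j => /=; last by rewrite mulr0 mul0r.
  by case: c d => [] [] //; rewrite mulr0 mul0r.
transitivity (fps_t * ((i, b) == (j, c))%:R : A) => //.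
rewrite xpair_eqE /sumE_diff /= eqxx.
have [->|_] := eqVneq i j => /=; last by rewrite /RX_comp !mul0r mulr0.
case: b c => [] [] /=; rewrite ?mulr0 ?mul0r ?/RX_comp ?mul0r //.
  exact: (ealphabeta (e j)).
exact: (ebetaalpha (e j)).
Qed.

Definition sumE : dob addRX fps_t := DOb sumE_diff2.

End DirectSum.

(* Objects of F(X) are the formal finite direct sums of objects E(x, y), i.e. *)
(* finite multisets of them; m is sent to the actual pair (P, d).             *)
Definition Fobj (m : multiset edata) : dob addRX fps_t :=
  sumE (tnth (in_tuple (m : seq edata))).

Definition Fcat : lincat A := @fullcat _ (dcat addRX fps_t) _ Fobj.

Definition diff_factors (M : dob addRX fps_t) : Prop :=
  exists xi : @mor _ addRX (phiob (dobj M)) (dobj M),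
    ddiff M = hcomp xi (@eta (dobj M)).

Record Fphi_ob := FphiOb {
  summands : multiset edata;
  summandsP : diff_factors (Fobj summands)
}.

Definition Fphi : lincat A := @fullcat _ Fcat Fphi_ob summands.

(* Maps factoring through a projective-injective object, i.e. through a       *)
(* finite direct sum of objects E(x, phi x).                                  *)
Definition projfact (M N : ob Fphi) (f : mor M N) : Prop :=
  exists (I : finType) (e : I -> edata),
    (forall i, ey (e i) = phi (ex (e i))) /\
    exists (g : dhom (Fobj (summands M)) (sumE e))
           (h : dhom (sumE e) (Fobj (summands N))), f = dcomp h g.

Definition projfact_pred (M N : ob Fphi) : {pred @mor _ Fphi M N} :=
  [pred f | `[< projfact f >]].

Let big_sum_bool (I1 I2 : finType) (F : (I1 + I2) * bool -> A^o) :
  \sum_u F u = \sum_(u : I1 * bool) F (inl u.1, u.2) +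
               \sum_(u : I2 * bool) F (inr u.1, u.2).
Proof.
transitivity (\sum_(i : I1 + I2) \sum_b F (i, b)).
  by rewrite pair_bigA; apply: eq_bigr => -[].
rewrite big_sumType; congr (_ + _); rewrite pair_bigA; exact: eq_bigr.
Qed.

Section SumOfTwo.
Variables (I1 I2 : finType) (e1 : I1 -> edata) (e2 : I2 -> edata).

Let e (i : I1 + I2) : edata :=
  match i with inl i => e1 i | inr i => e2 i end.

Section Into.
Variables (M : dob addRX fps_t) (g1 : dhom M (sumE e1)) (g2 : dhom M (sumE e2)).

Let pairf : @mor _ addRX (dobj M) (sumE_family e) := fun v u =>
  match v with
  | (inl i, b) => dhomval g1 (i, b) u
  | (inr i, b) => dhomval g2 (i, b) u
  end.

Fact sumE_pair_subproof : pairf \in @commdiff _ addRX fps_t M (sumE e).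
Proof.
apply: (introT (@commdiffP _ addRX fps_t M (sumE e) pairf)).
apply: hom_addRXP => v u.
have c1 i : hcomp (ddiff (sumE e1)) g1 (i, v.2) u = hcomp g1 (ddiff M) (i, v.2) u.
  by rewrite dhomE.
have c2 i : hcomp (ddiff (sumE e2)) g2 (i, v.2) u = hcomp g2 (ddiff M) (i, v.2) u.
  by rewrite dhomE.
rewrite comp_addRXE big_sum_bool; case: v c1 c2 => -[i|i] b /= c1 c2.
  rewrite [X in _ + X]big1 ?addr0 => [|j _]; last first.
    by rewrite /sumE_diff /= !mul0r.
  by apply: etrans (c1 i); apply: eq_bigr => -[].
rewrite [X in X + _]big1 ?add0r => [|j _]; last first.
  by rewrite /sumE_diff /= !mul0r.
by apply: etrans (c2 i); apply: eq_bigr => -[].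
Qed.

Definition sumE_pair : dhom M (sumE e) := DHom sumE_pair_subproof.
End Into.

Section From.
Variables (M : dob addRX fps_t) (h1 : dhom (sumE e1) M) (h2 : dhom (sumE e2) M).

Let copairf : @mor _ addRX (sumE_family e) (dobj M) := fun v u =>
  match u with
  | (inl i, b) => dhomval h1 v (i, b)
  | (inr i, b) => dhomval h2 v (i, b)
  end.

Fact sumE_copair_subproof : copairf \in @commdiff _ addRX fps_t (sumE e) M.
Proof.
apply: (introT (@commdiffP _ addRX fps_t (sumE e) M copairf)).
apply: hom_addRXP => v u.
have c1 i : hcomp (ddiff M) h1 v (i, u.2) = hcomp h1 (ddiff (sumE e1)) v (i, u.2).
  by rewrite dhomE.
have c2 i : hcomp (ddiff M) h2 v (i, u.2) = hcomp h2 (ddiff (sumE e2)) v (i, u.2).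
  by rewrite dhomE.
rewrite [RHS]comp_addRXE big_sum_bool; case: u c1 c2 => -[i|i] b /= c1 c2.
  rewrite [X in _ + X]big1 ?addr0 => [|j _]; last first.
    by rewrite /sumE_diff /= mulr0 mul0r.
  by apply: (etrans (c1 i)); apply: eq_bigr => -[].
rewrite [X in X + _]big1 ?add0r => [|j _]; last first.
  by rewrite /sumE_diff /= mulr0 mul0r.
by apply: (etrans (c2 i)); apply: eq_bigr => -[].
Qed.

Definition sumE_copair : dhom (sumE e) M := DHom sumE_copair_subproof.
End From.

Lemma sumE_copair_pair M N (g1 : dhom M (sumE e1)) (g2 : dhom M (sumE e2))
    (h1 : dhom (sumE e1) N) (h2 : dhom (sumE e2) N) :
  dcomp (sumE_copair h1 h2) (sumE_pair g1 g2) = dcomp h1 g1 + dcomp h2 g2.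
Proof.
apply/val_inj; apply: hom_addRXP => v u.
rewrite [LHS]comp_addRXE big_sum_bool.
transitivity (hcomp h1 g1 v u + hcomp h2 g2 v u) => //.
by rewrite !comp_addRXE; congr (_ + _); apply: eq_bigr => -[].
Qed.

End SumOfTwo.

Fact projfact_submod M N : submod_closed (@projfact_pred M N).
Proof.
split.
  apply/asboolP; exists void, (of_void edata); split; first by case.
  exists 0, 0; apply/val_inj; apply: hom_addRXP => v u.
  by rewrite [RHS]comp_addRXE big1 // => -[[]].
move=> a f f' /asboolP[I1 [e1 [p1 [g1 [h1 ->]]]]].
move=> /asboolP[I2 [e2 [p2 [g2 [h2 ->]]]]]; apply/asboolP.
exists (I1 + I2)%type, (fun i => match i with inl i => e1 i | inr i => e2 i end).
split; first by case.
exists (sumE_pair g1 g2), (sumE_copair (a *: h1) h2).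
rewrite sumE_copair_pair; congr (_ + _).
apply/val_inj; apply: hom_addRXP => v u; rewrite [RHS]comp_addRXE.
transitivity (a *: hcomp h1 g1 v u) => //; rewrite comp_addRXE scaler_sumr.
by apply: eq_bigr => w _; rewrite /GRing.scale /= !mulrA.
Qed.

Fact projfact_compl (M N L : ob Fphi) (g : @mor _ Fphi N L)
    (f : @mor _ Fphi M N) :
  f \in @projfact_pred M N -> hcomp g f \in @projfact_pred M L.
Proof.
move=> /asboolP[I [e [pe [g1 [h1 ->]]]]]; apply/asboolP.
exists I, e; split => //; exists g1, (dcomp g h1).
exact: (@compA _ (dcat addRX fps_t)).
Qed.

Fact projfact_compr (M N L : ob Fphi) (g : @mor _ Fphi N L)
    (f : @mor _ Fphi M N) :
  g \in @projfact_pred N L -> hcomp g f \in @projfact_pred M L.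
Proof.
move=> /asboolP[I [e [pe [g1 [h1 ->]]]]]; apply/asboolP.
exists I, e; split => //; exists (dcomp g1 f), h1.
exact/esym/(@compA _ (dcat addRX fps_t)).
Qed.

Definition projideal : catideal Fphi :=
  @CatIdeal _ Fphi projfact_pred projfact_submod projfact_compl projfact_compr.

Definition Ccan : lincat A := quotcat projideal.

End ClusterCategory.

Section Circle.
Variable R : realType.
Local Open Scope classical_set_scope.

(* Points of S^1 are represented by their angles. *)
Definition circle := {x : R | 0 <= x < 2 * pi}.

Lemma circleP (x : circle) : 0 <= val x < 2 * pi.
Proof. by case: x. Qed.

Definition angle (x y : circle) : R :=
  if val x <= val y then val y - val x else val y - val x + 2 * pi.

Definition angle_cocycle (x y z : circle) : nat :=
  (2 * pi <= angle x y + angle y z)%R.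

Lemma angle_cocycleE x y z :
  (angle_cocycle x y z)%:R * (2 * pi) = angle x y + angle y z - angle x z.
Proof.
have := circleP x; have := circleP y; have := circleP z.
rewrite /angle_cocycle /angle.
move=> /andP[z0 z1] /andP[y0 y1] /andP[x0 x1].
case: (leP (val x) (val y)) => xy; case: (leP (val y) (val z)) => yz;
  case: (leP (val x) (val z)) => xz; case: leP => xyz /=;
  rewrite ?mul0r ?mul1r; lra.
Qed.

Fact angle_cocycle_eq x y z w :
  (angle_cocycle x y z)%:Z - (angle_cocycle w y z)%:Z
    + (angle_cocycle w x z)%:Z - (angle_cocycle w x y)%:Z = 0.
Proof.
apply/eqP; rewrite -(intr_eq0 R).
have pi0 : 2 * pi != 0 :> R by rewrite mulf_neq0 ?gt_eqF ?pi_gt0.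
rewrite -(inj_eq (mulIf pi0)) mul0r.
have E a b c : (Posz (angle_cocycle a b c))%:~R * (2 * pi) =
    angle a b + angle b c - angle a c.
  by rewrite -pmulrn angle_cocycleE.
move: (2 * pi) E => p E.
rewrite !(rmorphB, rmorphD) /= !mulrDl !mulNr !E.
by apply/eqP; ring.
Qed.

Fact angle_cocyclexxy x y : angle_cocycle x x y = 0%N.
Proof.
have := circleP x; have := circleP y.
rewrite /angle_cocycle /angle lexx => /andP[y0 y1] /andP[x0 x1].
by case: (leP (val x) (val y)) => xy; case: leP => // ?; exfalso; lra.
Qed.

Fact angle_cocyclexyy x y : angle_cocycle x y y = 0%N.
Proof.
have := circleP x; have := circleP y.
rewrite /angle_cocycle /angle lexx => /andP[y0 y1] /andP[x0 x1].
by case: (leP (val x) (val y)) => xy; case: leP => // ?; exfalso; lra.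
Qed.

Definition circleposet (X : set circle) : cyclicPoset :=
  @CyclicPoset (set_type X)
    (fun x y z => angle_cocycle (val x) (val y) (val z))
    (fun x y z w => angle_cocycle_eq (val x) (val y) (val z) (val w))
    (fun x y => angle_cocyclexxy (val x) (val y))
    (fun x y => angle_cocyclexyy (val x) (val y)).

(* The first element of X met counterclockwise from x (x itself if none). *)
Definition succ_pt (X : set circle) (x : circleposet X) : circleposet X :=
  xget (x : set_type X) [set y : set_type X | y <> x /\
    forall w : set_type X, w <> x -> angle (val x) (val y) <= angle (val x) (val w)].

(* Hyperbolic geodesics in the Poincare disk model: p is on the geodesic with *)
(* ends x <> y when it lies in the open disk and on the circle or line        *)
(* a (|q|^2 + 1) = 2 (b, q), orthogonal to the unit circle, through x and y.  *)
Definition orthocircle (a : R) (b q : R * R) : Prop :=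
  a * (q.1 ^+ 2 + q.2 ^+ 2 + 1) = 2 * (b.1 * q.1 + b.2 * q.2).

Definition circle_pt (x : circle) : R * R := (cos (val x), sin (val x)).

Definition geodesic (x y : circle) : set (R * R) :=
  [set p | x <> y /\ p.1 ^+ 2 + p.2 ^+ 2 < 1 /\
    exists (a : R) (b : R * R), (a, b) <> (0, (0, 0)) /\
      orthocircle a b (circle_pt x) /\ orthocircle a b (circle_pt y) /\ orthocircle a b p].

(* Two geodesics without a common end cross when they meet. *)
Definition cross (x y w w' : circle) : Prop :=
  geodesic x y `&` geodesic w w' !=set0.

Definition chord_side (w w' q : R * R) : R :=
  (w'.1 - w.1) * (q.2 - w.2) - (w'.2 - w.2) * (q.1 - w.1).

Lemma pt_norm x : (circle_pt x).1 ^+ 2 + (circle_pt x).2 ^+ 2 = 1.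
Proof. exact: cos2Dsin2. Qed.

Lemma pt_inj : injective circle_pt.
Proof.
suff H (x y : circle) : circle_pt x = circle_pt y -> ~ (val x < val y).
  move=> x y xy; apply/val_inj/eqP; rewrite eq_le !leNgt.
  by apply/andP; split; apply/negP; apply: H.
move=> [cxy sxy] lxy.
have /andP[x0 x1] := circleP x; have /andP[y0 y1] := circleP y.
pose u := (val y - val x) / 2.
have s0 : 0 < sin u by apply: sin_gt0_pi; rewrite /u; apply/andP; split; lra.
have c1 : cos (u + u) = 1.
  rewrite (_ : u + u = val y - val x); last by rewrite /u; field.
  by rewrite cosB cxy sxy -!expr2 cos2Dsin2.
move: c1; rewrite cosD -!expr2 cos2sin2 => c1.
have : sin u ^+ 2 > 0 by rewrite exprn_gt0.
by lra.
Qed.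

Lemma side_neq0 x w w' : w <> w' -> x <> w -> x <> w' ->
  chord_side (circle_pt w) (circle_pt w') (circle_pt x) != 0.
Proof.
move=> ww xw xw'; apply/eqP.
have := pt_norm x; have := pt_norm w; have := pt_norm w'.
have [] : circle_pt w <> circle_pt w' /\ circle_pt x <> circle_pt w /\ circle_pt x <> circle_pt w'.
  by split; [|split] => /pt_inj.
case: (circle_pt x) (circle_pt w) (circle_pt w') => x1 x2 [w1 w2] [v1 v2]; rewrite /chord_side /=.
move=> ne1 [ne2 ne3] hv hw hx s0.
have eq0 (a b c d : R) : (a - c) ^+ 2 + (b - d) ^+ 2 = 0 -> (a, b) = (c, d).
  move=> /eqP; rewrite paddr_eq0 ?sqr_ge0 // !sqrf_eq0 !subr_eq0.
  by case/andP => /eqP -> /eqP ->.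
pose d1 := v1 - w1; pose d2 := v2 - w2; pose e1 := x1 - w1; pose e2 := x2 - w2.
have {}s0 : d1 * e2 - d2 * e1 = 0 by [].
have hd : 2 * (w1 * d1 + w2 * d2) = - (d1 ^+ 2 + d2 ^+ 2).
  by rewrite /d1 /d2; lra.
have he : 2 * (w1 * e1 + w2 * e2) = - (e1 ^+ 2 + e2 ^+ 2).
  by rewrite /e1 /e2; lra.
pose D := d1 ^+ 2 + d2 ^+ 2; pose E := e1 ^+ 2 + e2 ^+ 2.
pose P := d1 * e1 + d2 * e2.
have lag : D * E = P ^+ 2.
  have : D * E = P ^+ 2 + (d1 * e2 - d2 * e1) ^+ 2 by rewrite /D /E /P; ring.
  by rewrite s0 expr0n addr0.
have DE : D * E = P * D.
  have k1 : D * e1 = P * d1.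
    have : D * e1 = P * d1 - d2 * (d1 * e2 - d2 * e1) by rewrite /D /P; ring.
    by rewrite s0 mulr0 subr0.
  have k2 : D * e2 = P * d2.
    have : D * e2 = P * d2 + d1 * (d1 * e2 - d2 * e1) by rewrite /D /P; ring.
    by rewrite s0 mulr0 addr0.
  have E2 : E = - (2 * (w1 * e1 + w2 * e2)) by rewrite he opprK.
  have D2 : D = - (2 * (w1 * d1 + w2 * d2)) by rewrite hd opprK.
  have h : D * (w1 * e1 + w2 * e2) = P * (w1 * d1 + w2 * d2).
    by rewrite mulrDr mulrCA k1 (mulrCA _ w2) k2; ring.
  transitivity (- (2 * (D * (w1 * e1 + w2 * e2)))); first by rewrite E2; ring.
  by rewrite h [in RHS]D2; ring.
have D0 : D != 0.
  by apply/eqP => /(eq0 _ _ _ _)[? ?]; apply: ne1; congr (_, _).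
have EP : E = P by apply: (mulfI D0); rewrite DE mulrC.
have : P * (D - P) = 0 by rewrite mulrBr mulrC -EP lag EP expr2 subrr.
move/eqP; rewrite mulf_eq0 => /orP[/eqP P0|/eqP DP].
  by apply/ne2/eq0; rewrite -/e1 -/e2 -/E EP.
apply/ne3/eq0.
have -> : (x1 - v1) ^+ 2 + (x2 - v2) ^+ 2 = D + E - 2 * P.
  by rewrite /D /E /P /d1 /d2 /e1 /e2; ring.
by rewrite EP; lra.
Qed.

(* A crossing geodesic separates its two ends. *)
Lemma crossP x y w w' : x <> w -> x <> w' -> y <> w -> y <> w' -> w <> w' ->
  cross x y w w' <->
    chord_side (circle_pt w) (circle_pt w') (circle_pt x) * chord_side (circle_pt w) (circle_pt w') (circle_pt y) < 0.
Proof.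
move=> xw xw' yw yw' ww.
have sx0 := side_neq0 ww xw xw'; have sy0 := side_neq0 ww yw yw'.
have lineP u v (a : R) (b q : R * R) : u <> v -> (a, b) <> (0, (0, 0)) ->
    orthocircle a b (circle_pt u) -> orthocircle a b (circle_pt v) ->
    b.1 * q.1 + b.2 * q.2 = a -> chord_side (circle_pt u) (circle_pt v) q = 0.
  move=> /(contra_not (@pt_inj u v)) uv ab.
  have := pt_norm u; have := pt_norm v; rewrite /orthocircle /chord_side.
  case: (circle_pt u) (circle_pt v) uv b ab q => u1 u2 [v1 v2] /= uv [b1 b2] ab [q1 q2] /=.
  move=> -> -> hu hv hq.
  have {}hu : a = b1 * u1 + b2 * u2 by lra.
  have {}hv : a = b1 * v1 + b2 * v2 by lra.
  apply/eqP/negPn/negP => s0; apply: ab.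
  set d := (v1 - u1) * (q2 - u2) - (v2 - u2) * (q1 - u1) in s0.
  have b10 : b1 = 0.
    apply: (mulIf s0); rewrite mul0r.
    transitivity ((q2 - u2) * (b1 * v1 + b2 * v2 - (b1 * u1 + b2 * u2)) -
      (v2 - u2) * (b1 * q1 + b2 * q2 - (b1 * u1 + b2 * u2))).
      by rewrite /d; ring.
    by rewrite -hu -hv hq subrr !mulr0 subrr.
  have b20 : b2 = 0.
    apply: (mulIf s0); rewrite mul0r.
    transitivity ((v1 - u1) * (b1 * q1 + b2 * q2 - (b1 * u1 + b2 * u2)) -
      (q1 - u1) * (b1 * v1 + b2 * v2 - (b1 * u1 + b2 * u2))).
      by rewrite /d; ring.
    by rewrite -hu -hv hq subrr !mulr0 subrr.
  by rewrite hu b10 b20 !mul0r addr0.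
split=> [[p [[xy [p1 [a [b [ab [ax [ay ap]]]]]]] [_ [_ [c [d [cd [cw [cw' cp]]]]]]]]]|].
  pose n := p.1 ^+ 2 + p.2 ^+ 2 + 1.
  have n0 : 0 < n by rewrite /n ltr_wpDl ?addr_ge0 ?sqr_ge0.
  pose q : R * R := (2 * p.1 / n, 2 * p.2 / n).
  have onq a' b' : orthocircle a' b' p -> b'.1 * q.1 + b'.2 * q.2 = a'.
    rewrite /orthocircle -/n => h; apply: (mulIf (lt0r_neq0 n0)); rewrite h.
    by rewrite /q /=; field; rewrite lt0r_neq0.
  have sq := lineP _ _ _ _ _ ww cd cw cw' (onq _ _ cp).
  have tq := lineP _ _ _ _ _ xy ab ax ay (onq _ _ ap).
  have q1 : q.1 ^+ 2 + q.2 ^+ 2 < 1.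
    have -> : q.1 ^+ 2 + q.2 ^+ 2 = 4 * (n - 1) / n ^+ 2.
      by rewrite /q /n /=; field; rewrite lt0r_neq0.
    rewrite ltr_pdivrMr ?exprn_gt0 // mul1r -subr_gt0.
    have -> : n ^+ 2 - 4 * (n - 1) = (2 - n) ^+ 2 by ring.
    by rewrite exprn_gt0 // subr_gt0 /n; lra.
  have xyp : circle_pt x <> circle_pt y by move/pt_inj.
  move: tq sq q1 sx0 sy0; have := pt_norm x; have := pt_norm y; rewrite /chord_side.
  case: (circle_pt x) (circle_pt y) (circle_pt w) (circle_pt w') q xyp {onq}
    => x1 x2 [y1 y2] [w1 w2] [v1 v2] [q1 q2] /= xyp ny nx tq sq lq sx0 sy0.
  set sx := _ - _ in sx0 *; set sy := _ - _ in sy0 *.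
  pose D := (y1 - x1) ^+ 2 + (y2 - x2) ^+ 2.
  have D0 : D != 0.
    apply/eqP => /eqP; rewrite paddr_eq0 ?sqr_ge0 // !sqrf_eq0 !subr_eq0.
    by case/andP => /eqP y1x /eqP y2x; apply: xyp; rewrite y1x y2x.
  have Dp : 0 < D by rewrite lt0r D0 addr_ge0 ?sqr_ge0.
  pose s := ((y1 - x1) * (q1 - x1) + (y2 - x2) * (q2 - x2)) / D.
  have e1 : q1 = x1 + s * (y1 - x1).
    apply/eqP; rewrite addrC -subr_eq; apply/eqP/(mulIf D0).
    transitivity (s * D * (y1 - x1) - (y2 - x2) *
      ((y1 - x1) * (q2 - x2) - (y2 - x2) * (q1 - x1))).
      by rewrite /s divfK // /D; ring.
    by rewrite tq; ring.
  have e2 : q2 = x2 + s * (y2 - x2).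
    apply/eqP; rewrite addrC -subr_eq; apply/eqP/(mulIf D0).
    transitivity (s * D * (y2 - x2) + (y1 - x1) *
      ((y1 - x1) * (q2 - x2) - (y2 - x2) * (q1 - x1))).
      by rewrite /s divfK // /D; ring.
    by rewrite tq; ring.
  have s01 : 0 < s * (1 - s).
    rewrite -(pmulr_lgt0 _ Dp).
    suff -> : s * (1 - s) * D = 1 - (q1 ^+ 2 + q2 ^+ 2) by rewrite subr_gt0.
    rewrite e1 e2 -[X in _ = X - _](_ : (1 - s) * (x1 ^+ 2 + x2 ^+ 2) +
      s * (y1 ^+ 2 + y2 ^+ 2) = 1); last by rewrite nx ny; ring.
    by rewrite /D; ring.
  have mid : (1 - s) * sx + s * sy = 0.
    by rewrite -[RHS]sq /sx /sy e1 e2; ring.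
  have s0 : 0 < s by nra.
  have s1 : 0 < 1 - s by nra.
  rewrite -(pmulr_rlt0 _ s0).
  have -> : s * (sx * sy) = - ((1 - s) * sx ^+ 2).
    apply/eqP; rewrite -subr_eq0 opprK.
    have -> : s * (sx * sy) + (1 - s) * sx ^+ 2 = sx * ((1 - s) * sx + s * sy).
      by ring.
    by rewrite mid mulr0.
  by rewrite oppr_lt0 mulr_gt0 // exprn_even_gt0.
move=> sxy.
have xy : x <> y.
  by move=> E; move: sxy; rewrite E -expr2 ltNge sqr_ge0.
set sx := chord_side _ _ (circle_pt x) in sxy sx0; set sy := chord_side _ _ (circle_pt y) in sxy sy0.
have d0 : sx - sy != 0.
  by apply/eqP => /subr0_eq E; move: sxy; rewrite E -expr2 ltNge sqr_ge0.
pose s := sx / (sx - sy).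
pose q : R * R := ((circle_pt x).1 + s * ((circle_pt y).1 - (circle_pt x).1),
                   (circle_pt x).2 + s * ((circle_pt y).2 - (circle_pt x).2)).
have tq : chord_side (circle_pt x) (circle_pt y) q = 0 by rewrite /chord_side /q /=; ring.
have sq : chord_side (circle_pt w) (circle_pt w') q = 0.
  have -> : chord_side (circle_pt w) (circle_pt w') q = (1 - s) * sx + s * sy.
    by rewrite /sx /sy /chord_side /q /=; ring.
  by rewrite /s; field.
have s01 : 0 < s * (1 - s).
  have -> : s * (1 - s) = - (sx * sy) / (sx - sy) ^+ 2 by rewrite /s; field.
  by rewrite divr_gt0 ?oppr_gt0 // exprn_even_gt0.
have xyp : circle_pt x <> circle_pt y by move/pt_inj.
have q1 : q.1 ^+ 2 + q.2 ^+ 2 < 1.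
  have := pt_norm x; have := pt_norm y; rewrite /q {tq sq q}.
  case: (circle_pt x) (circle_pt y) xyp => x1 x2 [y1 y2] /= xyp ny nx.
  pose D := (y1 - x1) ^+ 2 + (y2 - x2) ^+ 2.
  have D0 : D != 0.
    apply/eqP => /eqP; rewrite paddr_eq0 ?sqr_ge0 // !sqrf_eq0 !subr_eq0.
    by case/andP => /eqP y1x /eqP y2x; apply: xyp; rewrite y1x y2x.
  have Dp : 0 < D by rewrite lt0r D0 addr_ge0 ?sqr_ge0.
  have : 0 < s * (1 - s) * D by rewrite mulr_gt0.
  suff -> : s * (1 - s) * D = 1 - ((x1 + s * (y1 - x1)) ^+ 2 +
    (x2 + s * (y2 - x2)) ^+ 2) by rewrite subr_gt0.
  rewrite -[X in _ = X - _](_ : (1 - s) * (x1 ^+ 2 + x2 ^+ 2) +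
      s * (y1 ^+ 2 + y2 ^+ 2) = 1); last by rewrite nx ny; ring.
  by rewrite /D; ring.
pose h := Num.sqrt (1 - (q.1 ^+ 2 + q.2 ^+ 2)).
have h2 : h ^+ 2 = 1 - (q.1 ^+ 2 + q.2 ^+ 2).
  by rewrite sqr_sqrtr // subr_ge0 ltW.
have hp : 0 < h by rewrite sqrtr_gt0 subr_gt0.
clearbody h; have h10 : 1 + h != 0 by rewrite gt_eqF // addr_gt0.
pose p : R * R := (q.1 / (1 + h), q.2 / (1 + h)).
have np : p.1 ^+ 2 + p.2 ^+ 2 = (1 - h) / (1 + h).
  have -> : p.1 ^+ 2 + p.2 ^+ 2 = (q.1 ^+ 2 + q.2 ^+ 2) / (1 + h) ^+ 2.
    by rewrite /p /=; field.
  have -> : q.1 ^+ 2 + q.2 ^+ 2 = 1 - h ^+ 2 by rewrite h2; ring.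
  by field.
have p1 : p.1 ^+ 2 + p.2 ^+ 2 < 1.
  rewrite np ltr_pdivrMr ?addr_gt0 // mul1r; lra.
clearbody q; have geo u v : u <> v -> chord_side (circle_pt u) (circle_pt v) q = 0 -> geodesic u v p.
  move=> uv suv; split => //; split => //.
  have uvp : circle_pt u <> circle_pt v by move/pt_inj.
  have := pt_norm u; have := pt_norm v; move: suv; rewrite /chord_side /orthocircle.
  case: (circle_pt u) (circle_pt v) uvp => u1 u2 [v1 v2] /= uvp suv nv nu.
  exists ((v1 - u1) * u2 - (v2 - u2) * u1), (- (v2 - u2), v1 - u1); split.
    move=> [_ /eqP E2 /eqP E1]; apply: uvp.
    by move: E1 E2; rewrite oppr_eq0 !subr_eq0 => /eqP -> /eqP ->.
  split; [|split] => /=.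
  - by rewrite nu; ring.
  - rewrite nv; apply/eqP; rewrite -subr_eq0; apply/eqP.
    by ring.
  - have -> : p.1 ^+ 2 + p.2 ^+ 2 + 1 = 2 / (1 + h) by rewrite np; field.
    rewrite /p /=; apply/eqP; rewrite -subr_eq0; apply/eqP.
    transitivity (- (2 / (1 + h)) * ((v1 - u1) * (q.2 - u2) - (v2 - u2) * (q.1 - u1))).
      by field.
    by rewrite suv mulr0.
by exists p; split; apply: geo.
Qed.

Definition angle_lift (Z : {fset circle}) (v : R) : Prop :=
  exists2 z, z \in Z & exists m : int, v = val z + 2 * pi * m%:~R.

Definition consecutive (Z : {fset circle}) (u v : R) : Prop :=
  angle_lift Z u /\ angle_lift Z v /\ u < v /\ forall w, angle_lift Z w -> ~ (u < w < v).

Definition Zinf (Z : {fset circle}) : set circle :=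
  [set x | exists (u v : R) (n m : int), consecutive Z u v /\
    val x + 2 * pi * m%:~R = (v + u) / 2 + (v - u) / pi * atan n%:~R].

Fact Zinf_notin Z x : Zinf Z x -> x \notin Z.
Proof.
move=> [u [v [n [m [[_ [_ [uv gap]]] e]]]]]; apply/negP => xZ.
apply: (gap (val x + 2 * pi * m%:~R)); first by exists x => //; exists m.
rewrite e; have pp := pi_gt0 R.
have a1 := atan_gtNpi2 (n%:~R : R); have a2 := atan_ltpi2 (n%:~R : R).
set A := atan _ in a1 a2 *.
have -> : (v - u) / pi * A = (v - u) * (A / pi) by rewrite mulrAC mulrA.
have b1 : - (1 / 2) < A / pi by rewrite ltr_pdivlMr //; lra.
have b2 : A / pi < 1 / 2 by rewrite ltr_pdivrMr //; lra.
move: (A / pi) b1 b2 => c b1 b2.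
have k1 : 0 < (v - u) * (1 / 2 + c) by rewrite mulr_gt0 ?subr_gt0 //; lra.
have k2 : 0 < (v - u) * (1 / 2 - c) by rewrite mulr_gt0 ?subr_gt0 //; lra.
by apply/andP; split; lra.
Qed.

Section Cactus.
Variables (Z : {fset circle}) (rho : rel Z).

(* a, b, c, d are distinct and in cyclic order; the cases with repetitions    *)
(* hold for every equivalence relation.                                       *)
Definition noncrossing_rel : Prop :=
  forall a b c d : Z,
    0 < angle (val a) (val b) < angle (val a) (val c) ->
    angle (val a) (val c) < angle (val a) (val d) ->
    rho a c -> rho b d -> [/\ rho a b, rho b c & rho c d].

Local Notation X := (circleposet (Zinf Z)).

Definition rho_noncrossing (x y : X) : Prop :=
  forall w w' : Z, rho w w' -> ~ cross (val x) (val y) (val w) (val w').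

Definition rho_crossing (x y : X) : nat := ~~ `[< rho_noncrossing x y >].

Lemma rho_noncrossingxx x : rho_noncrossing x x.
Proof. by move=> w w' _ [p [[]]]. Qed.

Lemma rho_noncrossing_trans x y z :
  rho_noncrossing x y -> rho_noncrossing y z -> rho_noncrossing x z.
Proof.
have neZ (u : X) (w : Z) : val u <> val w.
  have := Zinf_notin (set_mem (valP u)).
  by move=> /negP uZ e; apply: uZ; rewrite e; exact: valP.
move=> xy yz w w' ww; have [e|/eqP e] := eqVneq w w'.
  by rewrite e => -[p [_ []]].
have {}e : val w <> val w' by move/val_inj.
have crP u v : cross (val u) (val v) (val w) (val w') <-> _ :=
  crossP (neZ u w) (neZ u w') (neZ v w) (neZ v w') e.
have {}xy := contra_not (crP x y).2 (xy w w' ww).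
have {}yz := contra_not (crP y z).2 (yz w w' ww).
move=> /(crP x z) ac.
have sx := side_neq0 e (neZ x w) (neZ x w').
have sy := side_neq0 e (neZ y w) (neZ y w').
have sz := side_neq0 e (neZ z w) (neZ z w').
move: (chord_side _ _ (circle_pt (val x))) (chord_side _ _ (circle_pt (val y))) (chord_side _ _ (circle_pt (val z)))
  sx sy sz ac xy yz => a b c a0 b0 c0 ac /negP + /negP.
rewrite -!leNgt => ab bc.
have bb : 0 < b ^+ 2 by rewrite exprn_even_gt0.
have lt0 : (a * c) * b ^+ 2 < 0 by rewrite nmulr_rlt0.
suff : 0 <= (a * c) * b ^+ 2 by rewrite leNgt lt0.
have -> : (a * c) * b ^+ 2 = (a * b) * (b * c) by ring.
by rewrite mulr_ge0.
Qed.

Lemma rho_crossing_triangle x y z :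
  (rho_crossing x z <= rho_crossing x y + rho_crossing y z)%N.
Proof.
rewrite /rho_crossing; case: asboolP => //= xz.
case: asboolP => //= xy; case: asboolP => //= yz.
by case: xz; exact: rho_noncrossing_trans xy yz.
Qed.

(* The truncated subtraction is exact by rho_crossing_triangle. *)
Definition cactus_cocycle (x y z : X) : nat :=
  (cocycle x y z + rho_crossing x y + rho_crossing y z - rho_crossing x z)%N.

Lemma cactus_cocycleE x y z : (cactus_cocycle x y z + rho_crossing x z =
  cocycle x y z + rho_crossing x y + rho_crossing y z)%N.
Proof.
rewrite /cactus_cocycle subnK // -addnA.
exact: leq_trans (rho_crossing_triangle x y z) (leq_addl _ _).
Qed.

Fact cactus_cocycle_eq x y z w :
  (cactus_cocycle x y z)%:Z - (cactus_cocycle w y z)%:Z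
    + (cactus_cocycle w x z)%:Z - (cactus_cocycle w x y)%:Z = 0.
Proof.
have := cocycle_eq x y z w.
have := cactus_cocycleE x y z; have := cactus_cocycleE w y z.
have := cactus_cocycleE w x z; have := cactus_cocycleE w x y.
by lia.
Qed.

Let rho_crossingxx x : rho_crossing x x = 0%N.
Proof.
by rewrite /rho_crossing; case: asboolP => // -[]; exact: rho_noncrossingxx.
Qed.

Fact cactus_cocyclexxy x y : cactus_cocycle x x y = 0%N.
Proof. by rewrite /cactus_cocycle cocyclexxy rho_crossingxx subnn. Qed.

Fact cactus_cocyclexyy x y : cactus_cocycle x y y = 0%N.
Proof. by rewrite /cactus_cocycle cocyclexyy rho_crossingxx addn0 subnn. Qed.

Definition cactus : cyclicPoset :=
  @CyclicPoset X cactus_cocycle cactus_cocycle_eq cactus_cocyclexxy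
    cactus_cocyclexyy.

Definition rho_class :=
  {V : set X | exists x : X, V = [set y : X | rho_noncrossing x y]}.

Definition Ccan_rho (k : fieldType) : lincat (fps k) :=
  @fullcat _ (Ccan k (@succ_pt (Zinf Z)))
    {M : Fphi_ob k (@succ_pt (Zinf Z)) |
       forall E, E \in (summands M : seq _) -> rho_noncrossing (ex E) (ey E)}
    (@proj1_sig _ _).

End Cactus.
End Circle.

(* Main.v *)
Require Import Defs.
From mathcomp Require Import all_boot all_order all_algebra finmap multiset.
From mathcomp Require Import zify ring lra.
From mathcomp Require Import boolp classical_sets reals trigo.

(* In both stable categories, a morphism f into (Q, d) factors through a      *)
(* projective-injective object iff it lifts along the projective cover        *)
(* (1, d / eta) : Q + phi Q -> (Q, d), a condition on the matrix entries of f *)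
(* one pair of summands at a time. If E(x, y) and E(v, w) lie over different  *)
(* classes, a geodesic of rho separates x, y from v, w, and such a lift can   *)
(* be written down for every morphism; so only the diagonal blocks survive in *)
(* the stable category, and compositions through another class vanish. On     *)
(* triples x, y, z with x, y or y, z in one class the cactus cocycle equals   *)
(* that of the circle, and nothing else is used: hence both categories are    *)
(* the product of the C_can(V_k). The objects of the cactus category are      *)
(* noncrossing because c_rho(x, y, x) = 3 when x and y cross. There are       *)
(* finitely many classes since x is determined up to noncrossing by the set   *)
(* of the points of Z below x in [0, 2 pi).                                   *)

Set Implicit Arguments.
Unset Strict Implicit.
Unset Printing Implicit Defensive.

Import Order.TTheory GRing.Theory Num.Theory.

Local Open Scope ring_scope.

(** Both isomorphisms come from one statement, [near_objects_iso]. Given a cyclic poset with a map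
    [phi] and a relation [r] satisfying [separated], the full subcategory of the objects whose
    summands have both ends in one class is isomorphic to the product of the cluster categories of
    the classes. It applies to the circle by [separated_circle] and to the cactus by
    [separated_cactus]. The two products coincide, because the cocycles agree on each class, and
    every object of the cactus category has its summands inside classes by [cactus_edata].

    The functor sends a matrix to its diagonal blocks. A geodesic inside one class, seen from
    another class, has a first and a second end, and which is which does not depend on the viewpoint
    within that class. Hence every morphism between the two classes lifts to the projective cover of
    its target ([far_liftE]). So a morphism is stably zero exactly when its diagonal blocks are
    ([restrict_factors], [glue_factors]), and composition is respected ([restrict_comp_factors]). On
    objects the functor sorts a multiset of summands by class; it is bijective because there are
    finitely many classes. *)

(** * Power series: [t] is a cancellable non-unit *)

Section PowerSeriesTheory.
Variable k : fieldType.
Implicit Types a b : fps k.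
Local Notation t := (@fps_t k).

Lemma fps_mulE a b n : (a * b) n = \sum_(i < n.+1) a i * b (n - i)%N.
Proof. by []. Qed.

Lemma fps_t_mul0 a : (t * a) 0%N = 0.
Proof. by rewrite fps_mulE big_ord1 /fps_t mul0r. Qed.

Lemma fps_t_mulS a n : (t * a) n.+1 = a n.
Proof.
rewrite fps_mulE 2!big_ord_recl big1 => [|i _]; rewrite /fps_t /=.
  by rewrite mul0r mul1r add0r addr0 subn1.
by rewrite mul0r.
Qed.

Lemma fps_t_lreg : GRing.lreg t.
Proof.
move=> a b ab; apply/funext => n.
by rewrite -(fps_t_mulS a n) -(fps_t_mulS b n); congr (_ n.+1).
Qed.

(** Identities between matrix entries are often proved after multiplication by a power of [t], where
    the cocycle identity can be applied. *)
Lemma fps_tX_inj n a b : a * t ^+ n = b * t ^+ n -> a = b.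
Proof. by rewrite ![_ * t ^+ n]mulrC => /(@lregX _ _ n fps_t_lreg). Qed.

Lemma fps_t_nonunit a : t * a <> 1.
Proof.
by move=> /(congr1 (@^~ 0%N))/eqP; rewrite fps_t_mul0 eq_sym oner_eq0.
Qed.

End PowerSeriesTheory.

(** * Matrices between direct sums of objects E(x, y) *)

Definition flip (I : Type) (u : I * bool) : I * bool := (u.1, ~~ u.2).

Lemma flipK I : involutive (@flip I).
Proof. by case=> i []. Qed.

Section SumsOfE.
Variables (k : fieldType) (X : cyclicPoset).
Local Notation A := (fps k).
Local Notation t := (@fps_t k).
Local Notation c := (@cocycle X).

Definition vertex (I : finType) (e : I -> edata k X) (u : I * bool) : X :=
  if u.2 then ey (e u.1) else ex (e u.1).

(** The entry of d that leaves the end [u]; it arrives at [flip u]. *)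
Definition edge (I : finType) (e : I -> edata k X) (u : I * bool) : A :=
  if u.2 then ebeta (e u.1) else ealpha (e u.1).

(** This is [d^2 = t] read at the end [u], for both kinds of ends at once. *)
Lemma edge_flip (I : finType) (e : I -> edata k X) u :
  edge e u * edge e (flip u) *
    t ^+ c (vertex e u) (vertex e (flip u)) (vertex e u) = t.
Proof.
case: u => i []; rewrite /edge /vertex /= -[RHS]mulr1.
  have E : ealpha (e i) * ebeta (e i) *
    t ^+ c (ey (e i)) (ex (e i)) (ey (e i)) = t * 1 :> A := ealphabeta (e i).
  by rewrite -E (mulrC (ealpha _ : A)).
exact: etrans (congr1 (fun r : A => r * _) (mulrC (ealpha _ : A) _)) (ebetaalpha (e i)).
Qed.

Lemma sumE_diffE (I : finType) (e : I -> edata k X) v u :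
  @sumE_diff k X I e v u = (v == flip u)%:R * edge e u.
Proof.
case: v u => i a [j b]; rewrite /sumE_diff /edge xpair_eqE /=.
by case: (i == j); case: a b => [] []; rewrite ?mul1r ?mul0r.
Qed.

Variables (I J : finType) (a : I -> edata k X) (b : J -> edata k X).

Definition mat := J * bool -> I * bool -> A.

Lemma comp_diffl (f : mat) v u :
  @hcomp _ (addRX k X) (sumE_family a) (sumE_family b) (sumE_family b)
    (@sumE_diff k X J b) f v u =
  edge b (flip v) * f (flip v) u *
    t ^+ c (vertex a u) (vertex b (flip v)) (vertex b v).
Proof.
rewrite comp_addRXE (bigD1 (flip v)) //= big1 ?addr0 => [|w wv].
  by rewrite sumE_diffE flipK eqxx mul1r.
rewrite sumE_diffE; case: eqP => [vw|_]; last by rewrite !mul0r.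
by move: wv; rewrite vw flipK eqxx.
Qed.

Lemma comp_diffr (f : mat) v u :
  @hcomp _ (addRX k X) (sumE_family a) (sumE_family a) (sumE_family b)
    f (@sumE_diff k X I a) v u =
  f v (flip u) * edge a u *
    t ^+ c (vertex a u) (vertex a (flip u)) (vertex b v).
Proof.
rewrite comp_addRXE (bigD1 (flip u)) //= big1 ?addr0 => [|w /negPf wu].
  by rewrite sumE_diffE eqxx mul1r.
by rewrite sumE_diffE wu !(mulr0, mul0r).
Qed.

(** Commutation with the differentials, entry by entry: d has at most one nonzero entry in each row
    and column, so each composite is a single term. *)
Definition is_dmat (f : mat) := forall v u,
  edge b (flip v) * f (flip v) u *
    t ^+ c (vertex a u) (vertex b (flip v)) (vertex b v) =
  f v (flip u) * edge a u *
    t ^+ c (vertex a u) (vertex a (flip u)) (vertex b v).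

Lemma is_dmatP (f : mat) :
  is_dmat f <-> f \in @commdiff _ (addRX k X) fps_t (sumE a) (sumE b).
Proof.
split=> [fd|/(@commdiffP _ (addRX k X) fps_t (sumE a) (sumE b) f) fd v u].
  apply/(@commdiffP _ (addRX k X) fps_t (sumE a) (sumE b) f).
  apply: (@hom_addRXP _ _ (sumE_family a) (sumE_family b)) => v u.
  by rewrite comp_diffl comp_diffr; exact: fd.
rewrite -comp_diffl -comp_diffr.
by move/(congr1 (fun g : mat => g v u)): fd.
Qed.

Definition dmat_hom (f : mat) (fd : is_dmat f) : dhom (sumE a) (sumE b) :=
  @DHom _ (addRX k X) fps_t (sumE a) (sumE b) f ((is_dmatP f).1 fd).

Lemma dhom_dmat (f : dhom (sumE a) (sumE b)) : is_dmat (dhomval f).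
Proof. exact/is_dmatP/(@dhomP _ (addRX k X) fps_t (sumE a) (sumE b) f). Qed.

Lemma dhom_ext (f g : dhom (sumE a) (sumE b)) :
  (forall v u, dhomval f v u = dhomval g v u) -> f = g.
Proof.
move=> fg; apply/val_inj.
by apply: (@hom_addRXP _ _ (sumE_family a) (sumE_family b)).
Qed.

End SumsOfE.

(** * Factoring through projectives as a lifting problem *)

Section ProjectiveFactorization.
Variables (k : fieldType) (X : cyclicPoset) (phi : X -> X).
Local Notation A := (fps k).
Local Notation t := (@fps_t k).
Local Notation c := (@cocycle X).

(** The first condition makes the basis maps between [x] and [phi x] compose to [t]; the second is
    naturality of eta on basis morphisms. *)
Hypothesis phi_degree : forall x, c x (phi x) x = 1%N.
Hypothesis phi_natural : forall x y, c x (phi x) (phi y) = c x y (phi y).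

(** The condition [projfact] for sums over arbitrary finite index types, so that it applies to
    blocks without reference to multisets. *)
Definition factors_proj (I J : finType) (a : I -> edata k X)
    (b : J -> edata k X) (f : dhom (sumE a) (sumE b)) : Prop :=
  exists (L : finType) (e : L -> edata k X),
    (forall i, ey (e i) = phi (ex (e i))) /\
    exists (g : dhom (sumE a) (sumE e)) (h : dhom (sumE e) (sumE b)),
      f = dcomp h g.

Lemma zero_factors (I J : finType) (a : I -> edata k X) (b : J -> edata k X) :
  factors_proj (0 : dhom (sumE a) (sumE b)).
Proof.
exists void, (of_void _); split; first by case.
exists 0, 0; apply: dhom_ext => v u; symmetry.
by rewrite [LHS]comp_addRXE big1 // => -[[]].
Qed.

Section Criterion.
Variables (I J : finType) (a : I -> edata k X) (b : J -> edata k X).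
Local Notation p := (vertex a).
Local Notation q := (vertex b).

(* (u1, u2) is a morphism from (P, d) to the projective cover (Q + phi Q) of  *)
(* (Q, d'), and f is its composition with the cover (1, d' / eta).            *)
Definition lifting (f u1 u2 : mat k I J) :=
  (forall v u, u1 v u * t ^+ c (p u) (q v) (phi (q v)) =
    u2 v (flip u) * edge a u * t ^+ c (p u) (p (flip u)) (phi (q v))) /\
  (forall v u, f v u = u1 v u + edge b (flip v) * u2 (flip v) u *
    t ^+ c (p u) (phi (q (flip v))) (q v)).

(** This is the other half of commutation with the differential of the projective cover. Composing
    the first half with d on the source and using [d^2 = t] gives it up to a power of [t], which
    cancels. *)
Lemma lifting_dual f u1 u2 : lifting f u1 u2 ->
  forall v u, u2 v u * t ^+ c (p u) (phi (q v)) (q v) =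
    u1 v (flip u) * edge a u * t ^+ c (p u) (p (flip u)) (q v).
Proof.
move=> [C1 _] v u.
apply: (@fps_tX_inj _ (c (p (flip u)) (q v) (phi (q v)) + c (p u) (p (flip u)) (p u))).
have E := C1 v (flip u); rewrite flipK in E.
transitivity (u2 v u * t ^+ (1 + c (p (flip u)) (p u) (phi (q v)) +
    c (p u) (p (flip u)) (q v))).
  rewrite -mulrA -exprD; congr (_ * t ^+ _).
  have := cocycleA (p u) (p (flip u)) (q v) (phi (q v)).
  have := cocycleA (p u) (p (flip u)) (p u) (phi (q v)).
  have := cocycleA (p u) (q v) (phi (q v)) (q v).
  by rewrite cocyclexxy cocyclexyy phi_degree; lia.
transitivity ((u1 v (flip u) * t ^+ c (p (flip u)) (q v) (phi (q v))) * edge a u *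
  t ^+ (c (p u) (p (flip u)) (q v) + c (p u) (p (flip u)) (p u))).
  rewrite E; transitivity (u2 v u * (edge a u * edge a (flip u) *
    t ^+ c (p u) (p (flip u)) (p u)) * t ^+ c (p (flip u)) (p u) (phi (q v)) *
    t ^+ c (p u) (p (flip u)) (q v)); first by rewrite edge_flip !exprD expr1; ring.
  by rewrite !exprD; ring.
by rewrite !exprD; ring.
Qed.

(** Dividing d' by eta then costs no power of [t], so d' / eta has the same entries [edge b] as
    d'. *)
Hypothesis eta_flip : forall v, c (q (flip v)) (phi (q (flip v))) (q v) = 0%N.

(** Exponents in the naturality square of eta at the basis map from [y] to [z], precomposed with the
    one from [x] to [y]. *)
Lemma natural_phi x y z :
  (c x y z + c x z (phi z) = c x (phi y) (phi z) + c x y (phi y))%N.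
Proof.
have := cocycleA x y (phi y) (phi z); have := cocycleA x y z (phi z).
by have := phi_natural y z; lia.
Qed.

(** Commutation with d determines [h] from its part on the ends [w i]. That part composed with [g]
    gives [u1]; its image under phi, composed with the rest of [g], gives [u2]. *)
Lemma factors_proj_lifting (f : dhom (sumE a) (sumE b)) :
  factors_proj f -> exists u1 u2, lifting (dhomval f) u1 u2.
Proof.
move=> [L [e [ephi [g [h ->]]]]].
have gd := dhom_dmat g; have hd := dhom_dmat h.
pose w i := ex (e i).
pose u1 : mat k I J := fun v u => \sum_i dhomval h v (i, false) *
  dhomval g (i, false) u * t ^+ c (p u) (w i) (q v).
pose u2 : mat k I J := fun v u => \sum_i dhomval h v (i, false) *
  edge e (i, true) * dhomval g (i, true) u * t ^+ c (p u) (phi (w i)) (phi (q v)).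
have ve i : vertex e (i, true) = phi (w i) by rewrite /vertex /= ephi.
(* The loop from [w i] through [phi (w i)] already contributes the factor [t] of [d^2], so the
   entries of d on a projective summand are inverse units. *)
have ee i : edge e (i, true) * edge e (i, false) = 1.
  have := edge_flip e (i, false); rewrite /flip /= ve phi_degree expr1.
  by rewrite mulrC -[X in _ = X -> _]mulr1 => /fps_t_lreg; rewrite mulrC.
exists u1, u2; split=> v u.
  rewrite /u1 /u2 !mulr_suml; apply: eq_bigr => i _.
  have := gd (i, true) u; rewrite /flip /= -/(flip u) ve => G.
  transitivity (dhomval h v (i, false) * edge e (i, true) *
     (edge e (i, false) * dhomval g (i, false) u * t ^+ c (p u) (w i) (phi (w i)))
     * t ^+ c (p u) (phi (w i)) (phi (q v))).
    transitivity (dhomval h v (i, false) * (edge e (i, true) * edge e (i, false))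
      * dhomval g (i, false) u * t ^+ (c (p u) (w i) (q v) +
       c (p u) (q v) (phi (q v)))); first by rewrite ee exprD; ring.
    by rewrite natural_phi exprD; ring.
  rewrite [X in _ * X * _]G.
  transitivity (dhomval h v (i, false) * edge e (i, true) * dhomval g (i, true) (flip u)
    * edge a u * t ^+ (c (p u) (phi (w i)) (phi (q v)) + c (p u) (p (flip u)) (phi (w i)))).
    by rewrite exprD; ring.
  by rewrite -cocycleA exprD; ring.
transitivity (\sum_i \sum_(x : bool) dhomval h v (i, x) * dhomval g (i, x) u *
    t ^+ c (p u) (vertex e (i, x)) (q v)).
  by rewrite pair_bigA; apply: eq_bigr => -[].
rewrite /u1 /u2 mulr_sumr mulr_suml -big_split; apply: eq_bigr => i _.
rewrite big_bool ve; apply: etrans (addrC _ _) _; congr (_ + _).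
have := hd v (i, false); rewrite [flip (i, _)]/flip /= ve => H.
(* The entries of [h] on [phi (w i)] are expressed by those on [w i], after cancelling a power of
   [t]. *)
have {}H : dhomval h v (i, true) = edge b (flip v) * dhomval h (flip v) (i, false) *
    edge e (i, true) * t ^+ c (phi (w i)) (phi (q (flip v))) (q v).
  apply: (@fps_tX_inj _ (c (w i) (phi (w i)) (q v))).
  transitivity (dhomval h v (i, true) * edge e (i, false) *
      t ^+ c (w i) (phi (w i)) (q v) * edge e (i, true)).
    by rewrite -[LHS]mulr1 -(ee i); ring.
  rewrite -[X in X * _]H.
  rewrite -[RHS]mulrA -exprD (_ : (_ + _ = c (w i) (q (flip v)) (q v))%N); first by ring.
  have := cocycleA (w i) (phi (w i)) (phi (q (flip v))) (q v).
  have := cocycleA (w i) (q (flip v)) (phi (q (flip v))) (q v).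
  by have := phi_natural (w i) (q (flip v)); have := eta_flip v; lia.
rewrite H.
have := cocycleA (p u) (phi (w i)) (phi (q (flip v))) (q v) => E.
transitivity (edge b (flip v) * dhomval h (flip v) (i, false) * edge e (i, true)
  * dhomval g (i, true) u * t ^+ (c (phi (w i)) (phi (q (flip v))) (q v)
  + c (p u) (phi (w i)) (q v))); first by rewrite exprD; ring.
by rewrite E exprD; ring.
Qed.

Fact phi_edata_subproof x :
  @hcomp _ (RX k X) x (phi x) x 1 1 = fps_t *: @idm _ (RX k X) x /\
  @hcomp _ (RX k X) (phi x) x (phi x) 1 1 = fps_t *: @idm _ (RX k X) (phi x).
Proof.
have E : c (phi x) x (phi x) = 1%N.
  have := cocycleA x (phi x) x (phi x).
  by rewrite cocyclexxy cocyclexyy phi_degree; lia.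
have H n : n = 1%N -> 1 * 1 * t ^+ n = t * 1 :> A by move=> ->; rewrite !mulr1 mul1r.
by split; exact: H.
Qed.

Definition phi_edata x : edata k X :=
  EData (phi_edata_subproof x).1 (phi_edata_subproof x).2.

(** The factorization runs through the projective cover, the sum of E(q v, phi (q v)) over all ends
    [v] of the target, with [g] = (u1, u2) and [h] = (1, d' / eta). *)
Lemma lifting_factors_proj (f : dhom (sumE a) (sumE b)) u1 u2 :
  lifting (dhomval f) u1 u2 -> factors_proj f.
Proof.
move=> C; have C' := lifting_dual C; case: C => C1 C2.
pose e (v : J * bool) := phi_edata (q v).
pose g : mat k I (J * bool)%type := fun w u => if w.2 then u2 w.1 u else u1 w.1 u.
pose h : mat k (J * bool)%type J := fun v w =>
  if w.2 then (w.1 == flip v)%:R * edge b w.1 else (w.1 == v)%:R.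
have eE w : edge e w = 1 by rewrite /edge; case: ifP.
have gd : is_dmat a e g.
  move=> [v []] u; rewrite eE mul1r /g /vertex /=; first exact: C1.
  exact: C'.
have hd : is_dmat e b h.
  move=> v' [v []]; rewrite eE mulr1 /h /vertex /= -!/(vertex _ _); last first.
    case: eqP => [->|_]; last by rewrite mulr0 !mul0r.
    by rewrite eta_flip cocyclexxy !mulr1 mul1r.
  rewrite flipK; case: eqP => [->|_]; last by rewrite !(mul0r, mulr0).
  rewrite cocyclexyy !(mulr1, mul1r) ?expr0; apply: (@fps_tX_inj _ 1).
  rewrite mul1r -[RHS](edge_flip b v') -mulrA -exprD (mulrC (edge _ _)).
  have := cocycleA (q v') (phi (q v')) (q (flip v')) (q v').
  have := eta_flip (flip v'); rewrite flipK phi_degree => -> ->.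
  by rewrite addn0.
exists (J * bool)%type, e; split=> //.
exists (dmat_hom gd), (dmat_hom hd); apply: dhom_ext => v u.
rewrite C2; symmetry.
transitivity (\sum_(w : J * bool) \sum_(x : bool) h v (w, x) * g (w, x) u *
    t ^+ c (p u) (vertex e (w, x)) (q v)).
  by rewrite pair_bigA; apply: eq_bigr => -[].
rewrite exchange_big big_bool; apply: etrans (addrC _ _) _; rewrite /h /g /=; congr (_ + _).
  rewrite (bigD1 v) //= big1 => [|w /negPf ->]; last by rewrite !mul0r.
  by rewrite eqxx mul1r addr0 /vertex /= -/(vertex b v) cocyclexyy mulr1.
rewrite (bigD1 (flip v)) //= big1 => [|w /negPf ->]; last by rewrite !mul0r.
by rewrite eqxx mul1r addr0.
Qed.

End Criterion.
End ProjectiveFactorization.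

(* Each cocycle below has its first two or its last two arguments in the same *)
(* class, where the cactus cocycle agrees with that of the circle.            *)
Record separated (X : cyclicPoset) (phi : X -> X) (r : X -> X -> Prop) : Prop :=
  Separated {
  sep_refl : forall x, r x x;
  sep_sym : forall x y, r x y -> r y x;
  sep_trans : forall x y z, r x y -> r y z -> r x z;
  sep_phi : forall x, r x (phi x);
  phi_degree : forall x, cocycle x (phi x) x = 1%N;
  phi_natural : forall x y, cocycle x (phi x) (phi y) = cocycle x y (phi y);
  near_degree : forall x y, r x y -> x <> y -> cocycle x y x = 1%N;
  near_phi : forall x y, r x y -> x <> y -> cocycle x (phi x) y = 0%N;
  far_phi : forall x y, ~ r x y -> cocycle x y (phi y) = 0%N;
  far_const : forall x y v w, r x y -> r v w -> ~ r x v ->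
    cocycle v x y = cocycle w x y;
  far_cyclic : forall x y v, r x y -> ~ r x v -> cocycle x y v = cocycle v x y
}.

(** * Morphisms between different classes *)

Section Separated.
Variables (k : fieldType) (X : cyclicPoset) (phi : X -> X) (r : X -> X -> Prop).
Hypothesis sepX : separated phi r.
Local Notation A := (fps k).
Local Notation t := (@fps_t k).
Local Notation c := (@cocycle X).

Definition near_edge (E : edata k X) := r (ex E) (ey E) /\ ex E <> ey E.

Section FarBlocks.
Variables (I J : finType) (a : I -> edata k X) (b : J -> edata k X).
Local Notation p := (vertex a).
Local Notation q := (vertex b).
Hypothesis near_a : forall i, near_edge (a i).
Hypothesis near_b : forall j, near_edge (b j).

Lemma vertex_flip (L : finType) (e : L -> edata k X) (u : L * bool) :
  near_edge (e u.1) -> r (vertex e u) (vertex e (flip u)) /\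
    vertex e u <> vertex e (flip u).
Proof.
case: u => i [] [rE nE]; rewrite /vertex /=; last by split.
by split; [apply: (sep_sym sepX)|apply/nesym].
Qed.

Lemma near_edge_flip (L : finType) (e : L -> edata k X) (u : L * bool) :
  near_edge (e u.1) -> edge e u * edge e (flip u) = 1.
Proof.
move=> /(@vertex_flip _ e u)[ru nu]; have := edge_flip e u.
by rewrite (near_degree sepX) // expr1 mulrC -[X in _ = X -> _]mulr1 => /fps_t_lreg.
Qed.

(* The end u of the geodesic (u, flip u) precedes flip u as seen from v. *)
Definition precedes v u := c (q v) (p u) (p (flip u)) == 0%N.

(** A basis map from the first end of a geodesic to a far point passes through the second end at no
    cost in [t]. So [u1] keeps [f] on first ends, and [u2] holds the same columns moved to the
    second ends by the inverse of the entry of d. *)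
Definition far_lift1 (f : mat k I J) : mat k I J := fun v u =>
  if precedes v u then f v u else 0.

Definition far_lift2 (f : mat k I J) : mat k I J := fun v u =>
  if precedes v u then 0 else f v (flip u) * edge a u.

(** The loop from [p u] through [p (flip u)] has degree one, so exactly one of the two cocycles seen
    from [q v] vanishes. *)
Lemma precedes_flip v u : precedes v (flip u) = ~~ precedes v u.
Proof.
have [ru nu] := @vertex_flip _ a u (near_a _).
have := cocycleA (q v) (p u) (p (flip u)) (p u).
by rewrite /precedes flipK cocyclexyy (near_degree sepX) //; lia.
Qed.

Lemma precedes_near v w u : r (q v) (q w) -> ~ r (p u) (q v) ->
  precedes v u = precedes w u.
Proof.
move=> rvw far; rewrite /precedes; congr (_ == _).
have [ru _] := @vertex_flip _ a u (near_a _).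
exact: (far_const sepX).
Qed.

Lemma far_flip v u : ~ r (p u) (q v) -> ~ r (p (flip u)) (q v).
Proof.
have [ru _] := @vertex_flip _ a u (near_a _).
by move=> far /(sep_trans sepX ru).
Qed.

Lemma precedes_phi v u : ~ r (p u) (q v) -> precedes v u ->
  c (p u) (p (flip u)) (phi (q v)) = 0%N.
Proof.
move=> far /eqP pvu; have [ru _] := @vertex_flip _ a u (near_a _).
have rv := sep_phi sepX (q v).
rewrite (far_cyclic sepX) //; last first.
  by move=> /(sep_trans sepX)/(_ (sep_sym sepX rv)).
by rewrite -(far_const sepX ru rv far).
Qed.

Lemma far_lift_comm (f : mat k I J) v u : ~ r (p u) (q v) ->
  far_lift1 f v u * t ^+ c (p u) (q v) (phi (q v)) =
  far_lift2 f v (flip u) * edge a u *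
    t ^+ c (p u) (p (flip u)) (phi (q v)).
Proof.
move=> far; rewrite /far_lift1 /far_lift2 precedes_flip flipK.
case: ifP => pvu /=; last by rewrite !mul0r.
rewrite (far_phi sepX) // precedes_phi // -(mulrA (f v u)) (mulrC (edge _ _)).
by rewrite near_edge_flip // !mulr1.
Qed.

(** On a first end [u1] is [f] and [u2] vanishes. On a second end [u], commutation of [f] with d at
    [flip u] has exponent zero on the source side, so it can be solved for [f v u]; the result is
    the [u2] term. *)
Lemma far_liftE (f : mat k I J) v u : is_dmat a b f -> ~ r (p u) (q v) ->
  f v u = far_lift1 f v u + edge b (flip v) * far_lift2 f (flip v) u *
    t ^+ c (p u) (phi (q (flip v))) (q v).
Proof.
move=> fd far; have [rv nv] := @vertex_flip _ b v (near_b _).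
have far' : ~ r (p u) (q (flip v)).
  by move=> /(sep_trans sepX)/(_ (sep_sym sepX rv)).
rewrite /far_lift1 /far_lift2 -(precedes_near rv far).
case: ifP => pvu; first by rewrite mulr0 mul0r addr0.
have E := fd v (flip u); rewrite flipK in E.
have pvu' : precedes v (flip u) by rewrite precedes_flip pvu.
have := precedes_near rv (far_flip far); rewrite pvu' => /esym pvu''.
have E1 := precedes_phi (far_flip far') pvu''.
have E2 := near_phi sepX (sep_sym sepX rv) (nesym nv).
have E3 := far_phi sepX (far_flip far').
have E4 : c (p (flip u)) (p u) (q v) = 0%N.
  rewrite (far_cyclic sepX) ?(eqP pvu') //; last exact: far_flip.
    by have := eqP pvu'; rewrite flipK.
  by apply: (sep_sym sepX); have [] := @vertex_flip _ a u (near_a _).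
rewrite add0r -[LHS]mulr1 -(near_edge_flip (near_a (flip u).1)) flipK.
transitivity (f v u * edge a (flip u) * t ^+ 0 * edge a u).
  by rewrite expr0 mulr1 mulrA.
rewrite -E4 -E.
have -> : c (p u) (phi (q (flip v))) (q v) = c (p (flip u)) (q (flip v)) (q v).
  have := cocycleA (p (flip u)) (q (flip v)) (phi (q (flip v))) (q v).
  have := cocycleA (p (flip u)) (p u) (phi (q (flip v))) (q v).
  by rewrite flipK in E1; lia.
ring.
Qed.

End FarBlocks.

(** Spelled so that for [rho_noncrossing] it is convertible to [rho_class]. *)
Definition class_of_points := {V : set X | exists x, V = [set y | r x y]%classic}.
Local Notation K := class_of_points.

Definition point_class (x : X) : K :=
  exist _ [set y | r x y]%classic (ex_intro _ x erefl).

Lemma point_class_eq x y : r x y -> point_class x = point_class y.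
Proof.
move=> rxy; apply: eq_exist; apply/funext => z; apply/propext; split.
  exact: (sep_trans sepX (sep_sym sepX rxy)).
exact: (sep_trans sepX rxy).
Qed.

Lemma point_class_in (V : K) (x : X) : (x \in sval V) = (`[< point_class x = V >]).
Proof.
case: V => V [y E]; subst V; apply/idP/idP => [|/asboolP[E]].
  rewrite in_setE => ryx; apply/asboolP; rewrite -(point_class_eq ryx).
  exact: eq_exist.
by rewrite in_setE; have /= <- := congr1 (fun S : set X => S x) E; exact: (sep_refl sepX).
Qed.

Lemma point_classP x y : (point_class x = point_class y) <-> r x y.
Proof.
split=> [[E]|]; last exact: point_class_eq.
by have : [set z | r y z]%classic y by [exact: (sep_refl sepX)]; rewrite -E.
Qed.

(** * Classes as cyclic posets, and sums split by class *)

Section Subposet.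
Variable V : K.
Local Notation XV := (subposet (sval V)).
Local Notation phiV := (subauto phi (V := sval V)).

Lemma subposet_class (x : XV) : point_class (val x) = V.
Proof. by have := valP x; rewrite point_class_in => /asboolP. Qed.

Lemma val_subauto (x : XV) : val (phiV x) = phi (val x).
Proof.
apply: insubdK; rewrite -[_ \in _]/(phi (val x) \in sval V) point_class_in.
apply/asboolP; rewrite -[RHS](subposet_class x); apply/esym/point_class_eq.
exact: (sep_phi sepX).
Qed.

Lemma subposet_degree (x : XV) : cocycle x (phiV x) x = 1%N.
Proof. by rewrite /= val_subauto (phi_degree sepX). Qed.

Lemma subposet_natural (x y : XV) :
  cocycle x (phiV x) (phiV y) = cocycle x y (phiV y).
Proof. by rewrite /= !val_subauto (phi_natural sepX). Qed.

Definition lift_edata (E : edata k XV) : edata k X :=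
  @EData k X (val (ex E)) (val (ey E)) (ealpha E) (ebeta E)
    (ebetaalpha E) (ealphabeta E).

Lemma edata_ext (Y : cyclicPoset) (x y : Y) (al al' : A) (be be' : A) e1 e2 e1' e2' :
  al = al' -> be = be' ->
  @EData k Y x y al be e1 e2 = @EData k Y x y al' be' e1' e2'.
Proof.
move=> E1 E2; subst al' be'; congr EData; exact: Prop_irrelevance.
Qed.

Lemma lift_edata_inj : injective lift_edata.
Proof.
case=> [x y al be e1 e2] [x' y' al' be' e1' e2'] [] /val_inj E1 /val_inj E2.
by move: al be e1 e2 => /[swap]; rewrite E1 E2 => be al e1 e2 E3 E4; exact: edata_ext.
Qed.

Lemma lift_edata_surj (E : edata k X) :
  r (ex E) (ey E) -> point_class (ex E) = V -> exists E', E = lift_edata E'.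
Proof.
case: E => x y al be e1 e2 /= rxy cx.
have xV : x \in sval V by rewrite point_class_in; apply/asboolP.
have yV : y \in sval V.
  by rewrite point_class_in; apply/asboolP; rewrite -cx; exact/esym/point_class_eq.
exists (@EData k XV (exist _ x xV) (exist _ y yV) al be e1 e2).
exact: edata_ext.
Qed.

End Subposet.

(* sdata V lists the summands of a whose ends lie in V. *)
Record splitting (I : finType) (a : I -> edata k X) := Splitting {
  sidx : K -> finType;
  sdata : forall V, sidx V -> edata k (subposet (sval V));
  sinc : forall V, sidx V -> I;
  sinc_inj : forall V, injective (@sinc V);
  sincE : forall V i, a (sinc i) = lift_edata (@sdata V i);
  sinc_surj : forall i, exists V (j : sidx V), i = sinc j
}.

Section Split.
Variables (I : finType) (a : I -> edata k X) (S : splitting a).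

Definition sinc2 V (u : sidx S V * bool) : I * bool := (sinc u.1, u.2).

Lemma sinc2_inj V : injective (@sinc2 V).
Proof. by case=> [i x] [j y] [/sinc_inj -> ->]. Qed.

Lemma vertex_sinc V (u : sidx S V * bool) :
  vertex a (sinc2 u) = val (vertex (@sdata _ _ S V) u).
Proof. by case: u => i x; rewrite /vertex /= sincE; case: x. Qed.

Lemma edge_sinc V (u : sidx S V * bool) :
  edge a (sinc2 u) = edge (@sdata _ _ S V) u.
Proof. by case: u => i x; rewrite /edge /= sincE; case: x. Qed.

Lemma sinc2_class V (u : sidx S V * bool) :
  point_class (vertex a (sinc2 u)) = V.
Proof. by rewrite vertex_sinc subposet_class. Qed.

Lemma sinc2_surj (u : I * bool) : exists V (w : sidx S V * bool), u = sinc2 w.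
Proof.
case: u => i x; have [V [j ->]] := sinc_surj S i.
by exists V, (j, x).
Qed.

Definition sproj V (u : I * bool) : option (sidx S V * bool) :=
  [pick w | sinc2 w == u].

Lemma sprojK V (u : sidx S V * bool) : sproj V (sinc2 u) = Some u.
Proof.
rewrite /sproj; case: pickP => [w /eqP/sinc2_inj -> //|/(_ u)].
by rewrite eqxx.
Qed.

Lemma sproj_far V (u : I * bool) : point_class (vertex a u) <> V ->
  sproj V u = None.
Proof.
move=> far; rewrite /sproj; case: pickP => // w /eqP E.
by case: far; rewrite -E sinc2_class.
Qed.

End Split.

(** * Diagonal blocks: restriction, gluing and composition *)

Section Glue.
Variables (I J : finType) (a : I -> edata k X) (b : J -> edata k X).
Variables (Sa : splitting a) (Sb : splitting b).
Local Notation p := (vertex a).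
Local Notation q := (vertex b).

Definition restrict (f : mat k I J) V : mat k (sidx Sa V) (sidx Sb V) :=
  fun v u => f (sinc2 v) (sinc2 u).
Arguments restrict : clear implicits.

(** Diagonal blocks come from [g], all other entries from [f]. Looking both ends up with [sproj] in
    the class of [u] avoids transport along equalities of classes. *)
Definition glue (f : mat k I J) (g : forall V, mat k (sidx Sa V) (sidx Sb V)) :
    mat k I J := fun v u =>
  let V := point_class (p u) in
  match sproj Sb V v, sproj Sa V u with
  | Some v', Some u' => g V v' u'
  | _, _ => f v u
  end.

Lemma glue_near f g V v u : glue f g (sinc2 v) (sinc2 u) = g V v u.
Proof. by rewrite /glue sinc2_class !sprojK. Qed.

Lemma glue_far f g v u : ~ r (p u) (q v) -> glue f g v u = f v u.
Proof.
move=> far; rewrite /glue sproj_far //.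
by move=> /esym/point_classP.
Qed.

Lemma near_or_far v u : ~ r (p u) (q v) \/
  exists V (v' : sidx Sb V * bool) (u' : sidx Sa V * bool),
    v = sinc2 v' /\ u = sinc2 u'.
Proof.
have [V [u' ->]] := sinc2_surj Sa u; have [W [v' ->]] := sinc2_surj Sb v.
have [E|nE] := pselect (W = V); last first.
  by left=> /point_classP; rewrite !sinc2_class => /esym.
by subst W; right; exists V, v', u'.
Qed.

Lemma restrict_dmat f V : is_dmat a b f ->
  is_dmat (@sdata _ _ Sa V) (@sdata _ _ Sb V) (restrict f V).
Proof.
move=> fd v u; have := fd (sinc2 v) (sinc2 u).
rewrite -![flip (sinc2 _)]/(sinc2 (flip _)) !edge_sinc !vertex_sinc.
exact.
Qed.

Hypothesis near_a : forall i, near_edge (a i).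
Hypothesis near_b : forall j, near_edge (b j).

Lemma glue_dmat f g : is_dmat a b f ->
  (forall V, is_dmat (@sdata _ _ Sa V) (@sdata _ _ Sb V) (g V)) ->
  is_dmat a b (glue f g).
Proof.
move=> fd gd v u; have [far|[V [v' [u' [-> ->]]]]] := near_or_far v u.
  have [rv _] := vertex_flip (near_b v.1); have [ru _] := vertex_flip (near_a u.1).
  rewrite !glue_far; [exact: fd| |].
    by move=> /(sep_trans sepX ru).
  by move=> /(sep_trans sepX)/(_ (sep_sym sepX rv)).
rewrite -![flip (sinc2 _)]/(sinc2 (flip _)) !glue_near !edge_sinc !vertex_sinc.
exact: gd.
Qed.

Definition restrict_hom (f : dhom (sumE a) (sumE b)) V :
    dhom (sumE (@sdata _ _ Sa V)) (sumE (@sdata _ _ Sb V)) :=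
  dmat_hom (@restrict_dmat _ V (dhom_dmat f)).

(** A lifting is a condition on one pair of ends and their flips, and flips stay in their class, so
    liftings restrict to blocks. *)
Lemma restrict_factors (f : dhom (sumE a) (sumE b)) V :
  factors_proj phi f -> factors_proj (subauto phi (V := sval V)) (restrict_hom f V).
Proof.
move=> /(factors_proj_lifting (phi_degree sepX) (phi_natural sepX)) [].
  move=> v; have [rv nv] := vertex_flip (near_b v.1).
  exact: (near_phi sepX (sep_sym sepX rv) (nesym nv)).
move=> u1 [u2 [C1 C2]].
apply: (lifting_factors_proj (@subposet_degree V) _
  (u1 := restrict u1 V) (u2 := restrict u2 V)) => [v|]; last split=> v u.
- have [rv nv] := vertex_flip (near_b (sinc2 v).1).
  have := near_phi sepX (sep_sym sepX rv) (nesym nv).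
  by rewrite -![flip (sinc2 _)]/(sinc2 (flip _)) /= val_subauto !vertex_sinc.
- have := C1 (sinc2 v) (sinc2 u).
  rewrite -![flip (sinc2 _)]/(sinc2 (flip _)) /= val_subauto !vertex_sinc edge_sinc.
  exact.
- have := C2 (sinc2 v) (sinc2 u).
  rewrite -![flip (sinc2 _)]/(sinc2 (flip _)) /= val_subauto !vertex_sinc edge_sinc.
  exact.
Qed.

(** Liftings of the blocks are chosen independently and completed off the diagonal by [far_lift1]
    and [far_lift2]. *)
Lemma glue_factors (f : dhom (sumE a) (sumE b)) :
  (forall V, factors_proj (subauto phi (V := sval V)) (restrict_hom f V)) ->
  factors_proj phi f.
Proof.
move=> fV; have fd := dhom_dmat f.
have EU V : exists U : mat k (sidx Sa V) (sidx Sb V) *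
    mat k (sidx Sa V) (sidx Sb V),
    lifting (subauto phi (V := sval V)) (@sdata _ _ Sa V) (@sdata _ _ Sb V)
     (dhomval (restrict_hom f V)) U.1 U.2.
  have := factors_proj_lifting (@subposet_degree V) (@subposet_natural V) _ (fV V).
  case=> [v|u1 [u2 C]]; last by exists (u1, u2).
  have [rv nv] := vertex_flip (near_b (sinc2 v).1).
  have := near_phi sepX (sep_sym sepX rv) (nesym nv).
  by rewrite -![flip (sinc2 _)]/(sinc2 (flip _)) /= val_subauto !vertex_sinc.
pose U V := sval (cid (EU V)); have HU V := svalP (cid (EU V)).
apply: (lifting_factors_proj (phi_degree sepX) _
  (u1 := glue (far_lift1 a b (dhomval f)) (fun V => (U V).1))
  (u2 := glue (far_lift2 a b (dhomval f)) (fun V => (U V).2))).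
  move=> v; have [rv nv] := vertex_flip (near_b v.1).
  exact: (near_phi sepX (sep_sym sepX rv) (nesym nv)).
split=> v u; have [far|[V [v' [u' [-> ->]]]]] := near_or_far v u.
- rewrite !glue_far //; last exact: far_flip.
  exact: far_lift_comm.
- have := (HU V).1 v' u'.
  rewrite -![flip (sinc2 _)]/(sinc2 (flip _)) /= val_subauto !glue_near.
  by rewrite !vertex_sinc edge_sinc.
- have [rv _] := vertex_flip (near_b v.1).
  rewrite !glue_far //; first exact: far_liftE.
  by move=> /(sep_trans sepX)/(_ (sep_sym sepX rv)).
- have := (HU V).2 v' u'.
  rewrite -![flip (sinc2 _)]/(sinc2 (flip _)) /= val_subauto !glue_near.
  by rewrite !vertex_sinc edge_sinc.
Qed.

Definition glue_hom (f : dhom (sumE a) (sumE b))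
    (g : forall V, dhom (sumE (@sdata _ _ Sa V)) (sumE (@sdata _ _ Sb V))) :
    dhom (sumE a) (sumE b) :=
  dmat_hom (glue_dmat (dhom_dmat f) (fun V => dhom_dmat (g V))).

Lemma restrict_glue f g V : restrict_hom (glue_hom f g) V = g V.
Proof. by apply: dhom_ext => v u; exact: glue_near. Qed.

End Glue.

Section Composition.
Variables (I J L : finType).
Variables (a : I -> edata k X) (b : J -> edata k X) (d : L -> edata k X).
Variables (Sa : splitting a) (Sb : splitting b) (Sd : splitting d).
Hypothesis near_a : forall i, near_edge (a i).
Hypothesis near_b : forall j, near_edge (b j).
Hypothesis near_d : forall l, near_edge (d l).

Lemma restrict_id V : restrict_hom Sa Sa (did (sumE a)) V = did _.
Proof.
apply: dhom_ext => v u.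
transitivity ((sinc2 (S := Sa) v == sinc2 (S := Sa) u)%:R : A) => //.
by rewrite (inj_eq (@sinc2_inj _ _ Sa V)).
Qed.

Variables (f : dhom (sumE a) (sumE b)) (g : dhom (sumE b) (sumE d)).

(** Middle ends in [V] give the product of the blocks. The others only see the part of [f] between
    different classes, which is [f] with its diagonal blocks replaced by zero. *)
Lemma restrict_dcomp V : restrict_hom Sa Sd (dcomp g f) V =
  restrict_hom Sa Sd (dcomp g (glue_hom near_a near_b f (fun V => 0 :
    dhom (sumE (@sdata _ _ Sa V)) (sumE (@sdata _ _ Sb V))))) V +
  dcomp (restrict_hom Sb Sd g V) (restrict_hom Sa Sb f V).
Proof.
apply: dhom_ext => v u; set far := glue_hom _ _ _ _.
pose F (f' : mat k I J) w := (dhomval g (sinc2 v) w : A) * f' w (sinc2 u) *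
  t ^+ c (vertex a (sinc2 u)) (vertex b w) (vertex d (sinc2 v)).
transitivity (\sum_w F (dhomval f) w); first by [].
transitivity (\sum_w F (dhomval far) w + \sum_(w : sidx Sb V * bool)
    F (dhomval f) (sinc2 w)); last first.
  transitivity (\sum_w F (dhomval far) w + \sum_(w : sidx Sb V * bool)
     (dhomval (restrict_hom Sb Sd g V) v w : A) *
     dhomval (restrict_hom Sa Sb f V) w u *
     t ^+ c (val (vertex (@sdata _ _ Sa V) u)) (val (vertex (@sdata _ _ Sb V) w))
        (val (vertex (@sdata _ _ Sd V) v))); last by [].
  by congr (_ + _); apply: eq_bigr => w _; rewrite /F !vertex_sinc.
pose im := [set sinc2 (S := Sb) (V := V) w | w in [set: _]].
rewrite (bigID [in im]) [X in _ = X + _](bigID [in im]) /=.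
rewrite [X in _ = X + _ + _]big1 => [|_ /imsetP[w _ ->]]; last first.
  by rewrite /F /= glue_near mulr0 mul0r.
rewrite add0r addrC; congr (_ + _).
  apply: eq_bigr => w wim; rewrite /F /= glue_far // => /point_classP.
  rewrite sinc2_class; have [W [w' wE]] := sinc2_surj Sb w.
  rewrite wE sinc2_class => VW; subst W; move: wim.
  by rewrite wE imset_f.
rewrite big_imset => [|w w' _ _]; last exact: sinc2_inj.
by apply: eq_bigl => w; rewrite inE.
Qed.

(* Compositions through another class die in the stable category, since the   *)
(* part of f between different classes factors through projectives.           *)
Lemma restrict_comp_factors V : factors_proj (subauto phi (V := sval V))
  (restrict_hom Sa Sd (dcomp g f) V -
   dcomp (restrict_hom Sb Sd g V) (restrict_hom Sa Sb f V)).
Proof.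
rewrite restrict_dcomp addrK; apply: restrict_factors => //.
set far := glue_hom _ _ _ _.
have [D [e [eP [h [h' farE]]]]] : factors_proj phi far.
  by apply: (@glue_factors _ _ _ _ Sa Sb near_a near_b) => W;
    rewrite /far restrict_glue; exact: zero_factors.
exists D, e; split=> //; exists h, (dcomp g h'); rewrite farE; exact: dcompA.
Qed.

End Composition.
End Separated.

(** * Isomorphism of linear categories is symmetric and transitive *)

Section Isomorphisms.
Variable A : comNzRingType.

Lemma lincat_iso_trans (C D E : lincat A) :
  lincat_iso C D -> lincat_iso D E -> lincat_iso C E.
Proof.
move=> [F [Fo Fh]] [G [Go Gh]].
have GFid x : fhom G (fhom F (idm x)) = idm (fob G (fob F x)).
  by rewrite !fhom_id.
have GFcomp x y z (g : @mor _ C y z) (f : mor x y) :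
    fhom G (fhom F (hcomp g f)) = hcomp (fhom G (fhom F g)) (fhom G (fhom F f)).
  by rewrite !fhom_comp.
have GFlin x y a (f f' : @mor _ C x y) :
    fhom G (fhom F (a *: f + f')) = a *: fhom G (fhom F f) + fhom G (fhom F f').
  by rewrite !fhom_lin.
exists (LinFunctor GFid GFcomp GFlin); split=> /=; first exact: bij_comp.
by move=> x y; exact: bij_comp.
Qed.

(** An inverse on objects satisfies [fob F (g x) = x] only propositionally, so morphisms must be
    transported. *)
Definition cast_mor (C : lincat A) (x x' y y' : ob C) (ex : x = x') (ey : y = y')
    (f : mor x y) : mor x' y' :=
  eq_rect y (fun y => mor x' y) (eq_rect x (fun x => mor x y) f x' ex) y' ey.

Lemma lincat_iso_sym (C D : lincat A) : lincat_iso C D -> lincat_iso D C.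
Proof.
move=> [F [[g gK Kg] Fh]].
pose up x y (f : @mor _ D x y) := cast_mor (esym (Kg x)) (esym (Kg y)) f.
pose down x y (f : @mor _ D _ _) := cast_mor (Kg x) (Kg y) f.
have downK x y : cancel (@down x y) (@up x y).
  rewrite /down /up; move: (fob F (g x)) (Kg x) (fob F (g y)) (Kg y) => x' ex y' ey.
  by case: x / ex; case: y / ey.
have upK x y : cancel (@up x y) (@down x y).
  rewrite /down /up; move: (fob F (g x)) (Kg x) (fob F (g y)) (Kg y) => x' ex y' ey.
  by case: x / ex; case: y / ey.
have up_id x : up x x (idm x) = idm _.
  by rewrite /up; move: (fob F (g x)) (Kg x) => x' ex; case: x / ex.
have up_comp x y z (h : mor y z) (f : mor x y) :
    up x z (hcomp h f) = hcomp (up y z h) (up x y f).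
  rewrite /up; move: (fob F (g x)) (Kg x) (fob F (g y)) (Kg y) (fob F (g z)) (Kg z).
  move=> x' ex y' ey z' ez.
  by case: x / ex f; case: y / ey h; case: z / ez.
have up_lin x y a (f f' : mor x y) : up x y (a *: f + f') = a *: up x y f + up x y f'.
  rewrite /up; move: (fob F (g x)) (Kg x) (fob F (g y)) (Kg y) => x' ex y' ey.
  by case: x / ex f f'; case: y / ey.
have inv x y (h : mor (fob F x) (fob F y)) : exists f, fhom F f = h.
  by have [F' _ F'K] := Fh x y; exists (F' h).
pose G x y (f : mor x y) := sval (cid (inv (g x) (g y) (up x y f))).
have GK x y (f : mor x y) : fhom F (G x y f) = up x y f := svalP (cid (inv _ _ _)).
have Gid x : G x x (idm x) = idm (g x).
  by apply: (bij_inj (Fh _ _)); rewrite GK up_id fhom_id.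
have Gcomp x y z (h : mor y z) (f : mor x y) :
    G x z (hcomp h f) = hcomp (G y z h) (G x y f).
  by apply: (bij_inj (Fh _ _)); rewrite fhom_comp !GK up_comp.
have Glin x y a (f f' : mor x y) : G x y (a *: f + f') = a *: G x y f + G x y f'.
  by apply: (bij_inj (Fh _ _)); rewrite fhom_lin !GK up_lin.
exists (LinFunctor Gid Gcomp Glin); split=> /=; first by exists (fob F).
move=> x y; exists (fun f => down x y (fhom F f)) => f; first by rewrite GK upK.
by apply: (bij_inj (Fh _ _)); rewrite GK downK.
Qed.

End Isomorphisms.

(** * When d factors through eta *)

Section DifferentialFactors.
Variables (k : fieldType) (X : cyclicPoset) (phi : X -> X).
Variables (I : finType) (e : I -> edata k X).
Local Notation t := (@fps_t k).
Local Notation c := (@cocycle X).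
Local Notation p := (vertex e).

Lemma comp_eta (P Q : Defs.family X) (xi : @mor _ (addRX k X) (phiob phi P) Q) v u :
  hcomp xi (@eta k X phi P) v u =
  (xi v u : fps k) * t ^+ c (pts u) (phi (pts u)) (pts v).
Proof.
rewrite comp_addRXE (bigD1 u) //= big1 ?addr0 => [|w /negPf wu].
  by rewrite /eta eqxx mulr1.
by rewrite /eta wu mulr0 mul0r.
Qed.

Lemma diff_factors_sumE : (forall u, c (p u) (phi (p u)) (p (flip u)) = 0%N) ->
  diff_factors phi (sumE e).
Proof.
move=> e0; exists (@sumE_diff k X I e).
apply: (@hom_addRXP _ _ (sumE_family e) (sumE_family e)) => v u.
rewrite comp_eta; transitivity (@sumE_diff k X I e v u) => //.
rewrite sumE_diffE.
have [->|_] := eqVneq v (flip u); last by rewrite !mul0r.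
by rewrite -[c _ _ _]/(c (p u) (phi (p u)) (p (flip u))) e0 mulr1.
Qed.

(** If the ends coincided, factoring through eta would make both entries of d divisible by [t], and
    [d^2 = t] would make [t] a unit. *)
Lemma diff_factors_neq : (forall x, c x (phi x) x = 1%N) ->
  diff_factors phi (sumE e) -> forall i, ex (e i) <> ey (e i).
Proof.
move=> deg [xi xiE] i E.
have edgeE u : u.1 = i -> exists z, edge e u = t * z.
  move=> ui; exists (xi (flip u) u).
  have : @sumE_diff k X I e (flip u) u = hcomp xi (@eta k X phi (sumE_family e)) (flip u) u.
    by rewrite -xiE.
  rewrite comp_eta sumE_diffE eqxx mul1r => ->; rewrite mulrC.
  suff -> : c (@pts _ (sumE_family e) u) (phi (@pts _ (sumE_family e) u))
     (@pts _ (sumE_family e) (flip u)) = 1%N by [].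
  by case: u ui => j [] /= ->; rewrite ?E deg.
have [z ez] := edgeE (i, true) erefl; have [z' ez'] := edgeE (flip (i, true)) erefl.
have := edge_flip e (i, true); rewrite ez ez' -[RHS]mulr1 -!mulrA => /fps_t_lreg.
by rewrite mulrCA => /fps_t_nonunit.
Qed.

End DifferentialFactors.

(** A multiset is listed in an order of its own, so the summands in one class need not appear in the
    order they have in the whole object; an injection of positions is recovered from the
    permutation. *)
Lemma perm_filter_reindex (T' : Type) (T : eqType) (f : T' -> T) (P : pred T)
    (s1 : seq T') (s : seq T) :
  perm_eq (map f s1) [seq x <- s | P x] ->
  exists h : 'I_(size s1) -> 'I_(size s), [/\ injective h,
    forall i, tnth (in_tuple s) (h i) = f (tnth (in_tuple s1) i) &
    forall j, P (tnth (in_tuple s) j) -> exists i, j = h i].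
Proof.
pose js := [seq j <- enum 'I_(size s) | P (tnth (in_tuple s) j)].
have jsE : [seq x <- s | P x] = map (tnth (in_tuple s)) js.
  by rewrite -filter_map map_tnth_enum.
rewrite jsE; case: s1 => [|x0 s1] ps.
  have js0 : js = [::].
    by apply/nilP; rewrite /nilp -(size_map (tnth (in_tuple s))) -(perm_size ps).
  exists (fun i : 'I_0 => match notF (ltn_ord i) with end); split=> [[]|[]|j Pj] //.
  have : j \in js by rewrite mem_filter Pj mem_enum.
  by rewrite js0.
have [j0 _ _] : exists2 j, j \in js & f x0 = tnth (in_tuple s) j.
  by apply/mapP; rewrite -(perm_mem ps) mem_head.
have [Is pI s1E] := perm_iotaP (f x0) ps.
pose ls := map (nth j0 js) Is.
have pls : perm_eq ls js.
  rewrite -[X in perm_eq _ X](mkseq_nth j0) perm_map //.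
  by move: pI; rewrite size_map.
have s1ls : map f (x0 :: s1) = map (tnth (in_tuple s)) ls.
  rewrite s1E -map_comp; apply/eq_in_map => i.
  rewrite (perm_mem pI) mem_iota size_map => /= ilt.
  exact: nth_map.
have sls : size ls = size (x0 :: s1).
  by rewrite -(size_map f) s1ls size_map.
have uls : uniq ls by rewrite (perm_uniq pls) filter_uniq // enum_uniq.
exists (fun i => nth j0 ls i); split=> [i j /eqP|i|j Pj].
- by rewrite nth_uniq ?sls // => /eqP/val_inj.
- rewrite [in RHS](tnth_nth x0) -(nth_map x0 (f x0)) // [in RHS]s1ls.
  by rewrite (nth_map j0) // sls.
- have jls : j \in ls by rewrite (perm_mem pls) mem_filter Pj mem_enum.
  have lt : (index j ls < size (x0 :: s1))%N by rewrite -sls index_mem.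
  by exists (Ordinal lt); rewrite /= nth_index.
Qed.

(** * The isomorphism with the product over the classes *)

Section Decomposition.
Variables (k : fieldType) (X : cyclicPoset) (phi : X -> X) (r : X -> X -> Prop).
Hypothesis sepX : separated phi r.
Variables (T : finType) (sg : X -> T).
Hypothesis sg_near : forall x y, sg x = sg y -> r x y.
Local Notation A := (fps k).
Local Notation K := (class_of_points r).
Local Notation XV V := (subposet (sval (V : K))).
Local Notation phiV V := (subauto phi (V := sval (V : K))).

Definition lower_edata (V : K) (E : edata k X) : option (edata k (XV V)) :=
  if pselect (exists E', E = lift_edata E') is left h then Some (sval (cid h))
  else None.

Lemma lift_lowerK V : ocancel (lower_edata V) (@lift_edata k X r V).
Proof.
move=> E; rewrite /lower_edata; case: pselect => //= h.
by rewrite -(svalP (cid h)).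
Qed.

Lemma lower_liftK V : pcancel (@lift_edata k X r V) (lower_edata V).
Proof.
move=> E; rewrite /lower_edata; case: pselect => [h|[]]; last by exists E.
by congr Some; apply: lift_edata_inj; rewrite -(svalP (cid h)).
Qed.

Lemma count_lower V (E : edata k (XV V)) (s : seq (edata k X)) :
  count_mem E (pmap (lower_edata V) s) = count_mem (lift_edata E) s.
Proof.
elim: s => //= F s IH; have := lift_lowerK V F; have := lower_liftK E.
case EF : (lower_edata V F) => [F'|] /= EE FF'; rewrite IH.
  by rewrite -FF' (inj_eq (@lift_edata_inj _ _ _ _)).
by case: eqP => // E'; move: EE; rewrite -E' EF.
Qed.

Definition lower_mset (V : K) (m : multiset (edata k X)) : multiset (edata k (XV V)) :=
  seq_mset (pmap (lower_edata V) m).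

Lemma lower_msetE V m E : lower_mset V m E = m (lift_edata E).
Proof. by rewrite mset_seqE count_lower count_mem_mset. Qed.

Definition near_objects : Type := {M : Fphi_ob k phi |
  forall E, E \in (summands M : seq _) -> r (ex E) (ey E)}.

Lemma near_summands (M : near_objects) E :
  E \in (summands (sval M) : seq _) -> near_edge r E.
Proof.
case: M => M /= rM EM; split; first exact: rM.
have [i ->] := seq_tnthP EM.
exact: (diff_factors_neq (phi_degree sepX) (summandsP M)).
Qed.

Lemma near_lift V (E : edata k (XV V)) : near_edge r (lift_edata E) ->
  forall b (x := if b then ey E else ex E) (y := if b then ex E else ey E),
  cocycle x (phiV V x) y = 0%N.
Proof.
move=> [rE nE] [] /=; rewrite (val_subauto sepX); apply: (near_phi sepX) => //.
  exact: (sep_sym sepX).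
exact: nesym.
Qed.

Lemma lower_factors (M : near_objects) V :
  diff_factors (phiV V) (Fobj (lower_mset V (summands (sval M)))).
Proof.
apply: diff_factors_sumE => -[i b].
pose E := tnth (in_tuple (lower_mset V (summands (sval M)) : seq _)) i.
have EM : lift_edata E \in (summands (sval M) : seq _).
  by rewrite -mset_gt0 -lower_msetE mset_gt0 mem_tnth.
by have := near_lift (near_summands EM) b; case: b {EM}.
Qed.

Definition lower_ob (M : near_objects) V : Fphi_ob k (phiV V) :=
  FphiOb (lower_factors M V).

Lemma lower_reindex (M : near_objects) V :
  exists h : 'I_(size (lower_mset V (summands (sval M)))) ->
      'I_(size (summands (sval M))), [/\ injective h,
    forall i, tnth (in_tuple (summands (sval M) : seq _)) (h i) =
      lift_edata (tnth (in_tuple (lower_mset V (summands (sval M)) : seq _)) i) &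
    forall j, lower_edata V (tnth (in_tuple (summands (sval M) : seq _)) j) ->
      exists i, j = h i].
Proof.
apply: (@perm_filter_reindex _ _ _ (fun E => lower_edata V E : bool)).
rewrite -(pmap_filter (@lift_lowerK V)) perm_map //.
exact: perm_eq_seq_mset.
Qed.

Fact lower_sincE (M : near_objects) V i :
  tnth (in_tuple (summands (sval M) : seq _)) (sval (cid (lower_reindex M V)) i) =
  lift_edata (tnth (in_tuple (lower_mset V (summands (sval M)) : seq _)) i).
Proof. by have [_ + _] := svalP (cid (lower_reindex M V)); apply. Qed.

Fact lower_sinc_inj (M : near_objects) V : injective (sval (cid (lower_reindex M V))).
Proof. by have [] := svalP (cid (lower_reindex M V)). Qed.

Fact lower_sinc_surj (M : near_objects) i :
  exists V j, i = sval (cid (lower_reindex M V)) j.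
Proof.
have [rE _] := near_summands (mem_tnth i (in_tuple (summands (sval M) : seq _))).
have [E' EE'] := lift_edata_surj sepX rE erefl.
exists (point_class r (ex (tnth (in_tuple (summands (sval M) : seq _)) i))).
have [_ _] := svalP (cid (lower_reindex M (point_class r
  (ex (tnth (in_tuple (summands (sval M) : seq _)) i))))); apply.
by rewrite [X in lower_edata _ X]EE' lower_liftK.
Qed.

Definition ob_splitting (M : near_objects) :
    splitting r (tnth (in_tuple (summands (sval M) : seq _))) :=
  @Splitting k X r _ _
    (fun V => 'I_(size (lower_mset V (summands (sval M)))) : finType)
    (fun V => tnth (in_tuple (lower_mset V (summands (sval M)) : seq _)))
    (fun V => sval (cid (lower_reindex M V)))
    (@lower_sinc_inj M) (@lower_sincE M) (@lower_sinc_surj M).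

Local Notation near_cat := (@fullcat _ (Ccan k phi) near_objects (@proj1_sig _ _)).
Local Notation class_cat := (prodcat (fun V : K => Ccan k (phiV V))).

Definition restrict_ob (M N : near_objects)
    (f : dhom (Fobj (summands (sval M))) (Fobj (summands (sval N)))) V :
    dhom (Fobj (summands (lower_ob M V))) (Fobj (summands (lower_ob N V))) :=
  restrict_hom (ob_splitting M) (ob_splitting N) f V.

Definition lower_mor (M N : near_objects) (f : @mor _ near_cat M N) :
    @mor _ class_cat (lower_ob M) (lower_ob N) :=
  fun V => qclass (nul_submod (projideal k (phiV V)) (lower_ob M V) (lower_ob N V))
    (restrict_ob (qrepr f) V).

Lemma restrict_ob_lin M N a
    (f g : dhom (Fobj (summands (sval M))) (Fobj (summands (sval N)))) V :
  @restrict_ob M N (a *: f + g) V = a *: restrict_ob f V + restrict_ob g V.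
Proof. by apply: dhom_ext. Qed.

Lemma restrict_ob_sub M N
    (f g : dhom (Fobj (summands (sval M))) (Fobj (summands (sval N)))) V :
  @restrict_ob M N (f - g) V = restrict_ob f V - restrict_ob g V.
Proof. by apply: dhom_ext. Qed.

Lemma near_tnth (M : near_objects) i :
  near_edge r (tnth (in_tuple (summands (sval M) : seq _)) i).
Proof. exact/near_summands/mem_tnth. Qed.

(** Independence of the representative chosen in [lower_mor]. *)
Lemma lower_mor_qclass M N
    (f : dhom (Fobj (summands (sval M))) (Fobj (summands (sval N)))) V :
  @lower_mor M N (qclass (nul_submod (projideal k phi) (sval M) (sval N)) f) V =
  qclass _ (restrict_ob f V).
Proof.
apply/qclassP; rewrite -restrict_ob_sub; apply/asboolP.
set F := (X in restrict_ob X).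
have FP : factors_proj phi F.
  by have /asboolP := qreprP (nul_submod (projideal k phi) (sval M) (sval N)) f.
exact: (restrict_factors sepX (ob_splitting M) (ob_splitting N) (@near_tnth N) V FP).
Qed.

Lemma restrict_factorsE M N f :
  factors_proj phi f <-> forall V, factors_proj (phiV V) (@restrict_ob M N f V).
Proof.
split=> [fP V|].
  exact: (restrict_factors sepX (ob_splitting M) (ob_splitting N) (@near_tnth N) V fP).
exact: (@glue_factors _ _ _ _ sepX _ _ _ _ (ob_splitting M) (ob_splitting N)
  (@near_tnth M) (@near_tnth N) f).
Qed.

Fact lower_mor_id (M : ob near_cat) : lower_mor (idm M) = @idm _ class_cat (lower_ob M).
Proof.
apply: functional_extensionality_dep => V.
apply: etrans (lower_mor_qclass _ _) _; congr (qclass _ _).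
exact: (restrict_id (ob_splitting M)).
Qed.

Fact lower_mor_comp (M N L : ob near_cat) (g : mor N L) (f : mor M N) :
  lower_mor (hcomp g f) = @hcomp _ class_cat _ _ _ (lower_mor g) (lower_mor f).
Proof.
apply: functional_extensionality_dep => V.
apply: etrans (lower_mor_qclass _ _) _.
have E := @quot_compE _ _ (projideal k (phiV V)) (lower_ob M V) (lower_ob N V)
  (lower_ob L V) (restrict_ob (qrepr g) V) (restrict_ob (qrepr f) V).
apply: (etrans _ (esym E)) => {E}.
apply/qclassP/asboolP.
exact: (restrict_comp_factors sepX (ob_splitting M) (ob_splitting N) (ob_splitting L)
  (@near_tnth M) (@near_tnth N) (@near_tnth L)).
Qed.

Fact lower_mor_lin (M N : ob near_cat) (x : A) (f f' : mor M N) :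
  lower_mor (x *: f + f') = x *: lower_mor f + lower_mor f' :> @mor _ class_cat _ _.
Proof.
apply: functional_extensionality_dep => V.
rewrite -[f in LHS]qreprK -[f' in LHS]qreprK -qclassZ -qclassD lower_mor_qclass.
by rewrite restrict_ob_lin qclassD qclassZ.
Qed.

Definition lower_functor : linfunctor near_cat class_cat :=
  @LinFunctor _ near_cat class_cat lower_ob lower_mor
    lower_mor_id lower_mor_comp lower_mor_lin.

(** The inverse glues representatives of the blocks with zero off the diagonal; it is two-sided
    because a morphism with stably zero blocks is stably zero. *)
Lemma lower_mor_bij (M N : ob near_cat) : bijective (@lower_mor M N).
Proof.
pose G (h : @mor _ class_cat (lower_ob M) (lower_ob N)) : @mor _ near_cat M N :=
  qclass (nul_submod (projideal k phi) (sval M) (sval N))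
   (glue_hom sepX (Sa := ob_splitting M) (Sb := ob_splitting N)
     (@near_tnth M) (@near_tnth N) 0 (fun V => qrepr (h V))).
have GK : cancel G (@lower_mor M N).
  move=> h; apply: functional_extensionality_dep => V.
  apply: etrans (lower_mor_qclass _ _) _; rewrite -[RHS]qreprK; congr (qclass _ _).
  exact: (restrict_glue sepX (Sa := ob_splitting M) (Sb := ob_splitting N)).
exists G => // f; have := GK (lower_mor f); move: (G _) => f' E.
rewrite -[f']qreprK -[f]qreprK; apply/qclassP/asboolP/restrict_factorsE => V.
rewrite restrict_ob_sub; apply/asboolP.
apply/(@qclassP _ _ _ (nul_submod (projideal k (phiV V)) (lower_ob M V) (lower_ob N V))).
exact: (congr1 (fun F : @mor _ class_cat _ _ => F V) E).
Qed.

(** The multiplicity of a summand with ends in one class can be read off in the block of that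
    class. *)
Lemma lower_ob_inj : injective lower_ob.
Proof.
move=> [M rM] [N rN] /= E; apply: eq_exist.
suff MN : summands M = summands N.
  case: M N MN {rM rN E} => [m pm] [n pn] /= mn; subst n.
  by congr FphiOb; exact: Prop_irrelevance.
apply/msetP => F; have [rF|nF] := pselect (r (ex F) (ey F)); last first.
  have notin (m : multiset (edata k X)) :
      (forall E, E \in (m : seq _) -> r (ex E) (ey E)) -> m F = 0%N.
    by move=> rm; apply/mset_eq0P/negP => /rm.
  by rewrite !notin.
have [F' ->] := lift_edata_surj sepX rF erefl.
rewrite -!lower_msetE; set V := point_class _ _.
by move: (congr1 (fun O : forall V, _ => summands (O V)) E) => /= ->.
Qed.

Lemma point_class_surj (V : K) : exists x, point_class r x = V.
Proof.
by case: V => V [x E]; subst V; exists x; exact: eq_exist.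
Qed.

(** Codes are injective with values in a finite type. This is how finiteness of the number of
    classes enters, making the union of a family of blocks a finite multiset. *)
Definition class_code (V : K) : T := sg (sval (cid (point_class_surj V))).

Lemma class_code_inj : injective class_code.
Proof.
move=> V W /sg_near; rewrite /class_code.
case: cid => x /= <-; case: cid => y /= <-; exact: (point_class_eq sepX).
Qed.

Section Union.
Variable N : forall V : K, Fphi_ob k (phiV V).

Definition class_block (z : T) : seq (edata k X) :=
  if pselect (exists V, class_code V = z) is left h
  then let V := sval (cid h) in
    map (@lift_edata k X r V) (summands (N V) : seq _)
  else [::].

Lemma class_blockE V :
  class_block (class_code V) = map (@lift_edata k X r V) (summands (N V) : seq _).
Proof.
rewrite /class_block; case: pselect => [h|[]]; last by exists V.
by case: cid => /= W /class_code_inj ->.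
Qed.

Lemma mem_class_block z E : E \in class_block z -> exists V E',
  [/\ E = @lift_edata k X r V E', z = class_code V & E' \in (summands (N V) : seq _)].
Proof.
rewrite /class_block; case: pselect => // h; case: cid => /= V <-.
by move=> /mapP[E' ? ->]; exists V, E'.
Qed.

Definition union_mset : multiset (edata k X) :=
  seq_mset (flatten [seq class_block z | z <- enum T]).

Lemma union_mset_near E : E \in (union_mset : seq _) -> near_edge r E.
Proof.
rewrite (perm_mem (perm_eq_seq_mset _)) => /flatten_mapP[z _].
move=> /mem_class_block[V [E' [-> _ E'N]]]; split=> /=.
  by apply/(point_classP sepX); rewrite !(subposet_class sepX).
have [i ->] := seq_tnthP E'N; move=> /val_inj.
exact: (diff_factors_neq (@subposet_degree _ _ _ sepX V) (summandsP (N V))).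
Qed.

Lemma union_factors : diff_factors phi (Fobj union_mset).
Proof.
apply: diff_factors_sumE => u.
have uN := union_mset_near (mem_tnth u.1 (in_tuple (union_mset : seq _))).
have [ru nu] := vertex_flip sepX (e := tnth (in_tuple (union_mset : seq _))) uN.
exact: (near_phi sepX).
Qed.

Lemma lower_union V : lower_mset V union_mset = summands (N V).
Proof.
apply/msetP => E; rewrite lower_msetE /union_mset mset_seqE count_flatten sumnE.
rewrite !big_map (bigD1 (class_code V)) //= big1 ?addn0.
  rewrite class_blockE count_map -[RHS]count_mem_mset; apply: eq_count => F /=.
  exact: (inj_eq (@lift_edata_inj _ _ _ _)).
move=> z zV; apply/count_memPn/negP => /mem_class_block[W [E' [EE' zW _]]].
move/eqP: zV; apply; rewrite zW; congr class_code.
by rewrite -(subposet_class sepX (ex E)) -(subposet_class sepX (ex E'))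
  -[val (ex E)]/(ex (lift_edata E)) EE'.
Qed.

End Union.

Lemma lower_ob_bij : bijective lower_ob.
Proof.
pose G (N : forall V : K, Fphi_ob k (phiV V)) : near_objects :=
  exist (fun M : Fphi_ob k phi => forall E, E \in (summands M : seq _) ->
    r (ex E) (ey E)) (FphiOb (union_factors N))
    (fun E (EN : E \in (union_mset N : seq _)) => (union_mset_near EN).1).
have GK : cancel G lower_ob.
  move=> N; apply: functional_extensionality_dep => V.
  have : summands (lower_ob (G N) V) = summands (N V) by exact: lower_union.
  case: (lower_ob _ V) (N V) => [m pm] [n pn] /= mn; subst n.
  by congr FphiOb; exact: Prop_irrelevance.
by exists G => // M; apply: lower_ob_inj; rewrite GK.
Qed.

Theorem near_objects_iso : lincat_iso near_cat class_cat.
Proof. by exists lower_functor; split; [exact: lower_ob_bij|exact: lower_mor_bij]. Qed.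

End Decomposition.

(** * Cocycle and crossing in terms of the order on [0, 2 pi) *)

Section Angles.
Variable R : realType.
Implicit Types x y z w : circle R.

Lemma angle_bounds x y : 0 <= angle x y < 2 * pi.
Proof.
have /andP[x0 x1] := circleP x; have /andP[y0 y1] := circleP y.
by rewrite /angle; case: (leP (val x)) => xy; apply/andP; split; lra.
Qed.

Lemma angle_gt0 x y : x <> y -> 0 < angle x y.
Proof.
move=> xy; have /andP[x0 x1] := circleP x; have /andP[y0 y1] := circleP y.
rewrite /angle; case: (leP (val x)) => [lexy|]; last lra.
by rewrite subr_gt0 lt_neqAle lexy andbT; apply/eqP => /val_inj.
Qed.

Lemma angleC x y : x <> y -> angle x y + angle y x = 2 * pi.
Proof.
move=> xy; have : val x != val y by apply/eqP => /val_inj.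
by rewrite /angle; case: (ltgtP (val x) (val y)) => // *; lra.
Qed.

Lemma angle_unique x y (d : R) (m : int) :
  0 <= d < 2 * pi -> val y + 2 * pi * m%:~R = val x + d -> angle x y = d.
Proof.
move=> /andP[d0 d1] E; have /andP[a0 a1] := angle_bounds x y.
have [j aE] : exists j : int, angle x y = val y - val x + 2 * pi * j%:~R.
  rewrite /angle; case: (leP (val x)) => _; [exists 0|exists 1];
    by rewrite ?mulr0 ?addr0 ?mulr1.
have p2 : 0 < 2 * pi :> R by rewrite mulr_gt0 // pi_gt0.
have E2 : angle x y - d = 2 * pi * (j - m)%:~R.
  have -> : d = val y + 2 * pi * m%:~R - val x by rewrite E; ring.
  by rewrite aE rmorphB /=; ring.
suff jm : j - m = 0 by apply/eqP; rewrite -subr_eq0 E2 jm mulr0.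
have lt1 : (j - m)%:~R < 1 :> R by rewrite -(ltr_pM2l p2) -E2; lra.
have gt1 : -1 < (j - m)%:~R :> R by rewrite -(ltr_pM2l p2) -E2; lra.
move: lt1 gt1; rewrite -[1]/(1%:~R : R) -mulrNz !ltr_int; lia.
Qed.

Lemma add_angle x y : exists m : int, val y + 2 * pi * m%:~R = val x + angle x y.
Proof.
rewrite /angle; case: (leP (val x)) => _; [exists 0|exists 1];
    by rewrite ?mulr0 ?mulr1; lra.
Qed.

Lemma angle_ltE x y :
  angle x y = val y - val x + (val y < val x)%R%:R * (2 * pi).
Proof. by rewrite /angle; case: (leP (val x)) => _; rewrite ?mul0r ?mul1r ?addr0. Qed.

(** An angle is a difference of coordinates plus a full turn at each descent, so the cocycle counts
    descents on the circle cut at angle 0. *)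
Lemma angle_cocycle_lt x y z : (angle_cocycle x y z + (val z < val x)%R =
  (val y < val x)%R + (val z < val y)%R)%N.
Proof.
have p0 : 2 * pi != 0 :> R by rewrite mulf_neq0 // gt_eqF ?pi_gt0.
apply/eqP; rewrite -(eqr_nat R) -(inj_eq (mulIf p0)) !natrD !mulrDl; apply/eqP.
by rewrite angle_cocycleE !angle_ltE; ring.
Qed.

(** Twice the signed area of an inscribed triangle is a product of sines of half the angle
    differences. *)
Lemma chord_sideE w w' x : chord_side (circle_pt w) (circle_pt w') (circle_pt x) =
  4 * sin ((val w' - val w) / 2) * sin ((val x - val w') / 2) *
    sin ((val x - val w) / 2).
Proof.
have dbl (a : R) : a = a / 2 + a / 2 by lra.
rewrite /chord_side /circle_pt /= !mulrBl !sinB.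
rewrite (dbl (val w)) (dbl (val w')) (dbl (val x)) !cosD !sinD -!dbl.
have := cos2Dsin2 (val w / 2); have := cos2Dsin2 (val w' / 2).
have := cos2Dsin2 (val x / 2).
move: (cos _) (sin _) (cos _) (sin _) (cos _) (sin _) => cw sw cw' sw' cx sx Ex Ew' Ew.
(* Each product of double-angle terms is made homogeneous by the factor cos^2 + sin^2 = 1 of the
   third half angle. *)
transitivity (((2 * sx * cx) * (cw' ^+ 2 - sw' ^+ 2) - (2 * sw' * cw') * (cx ^+ 2 - sx ^+ 2))
    * (cw ^+ 2 + sw ^+ 2) +
  ((2 * sw * cw) * (cx ^+ 2 - sx ^+ 2) - (2 * sx * cx) * (cw ^+ 2 - sw ^+ 2))
    * (cw' ^+ 2 + sw' ^+ 2) +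
  ((2 * sw' * cw') * (cw ^+ 2 - sw ^+ 2) - (2 * sw * cw) * (cw' ^+ 2 - sw' ^+ 2))
    * (cx ^+ 2 + sx ^+ 2)).
  by rewrite Ex Ew Ew'; ring.
ring.
Qed.

Lemma sin_half_sub x y : val x != val y ->
  (sin ((val x - val y) / 2) < 0) = (val x < val y).
Proof.
have pos (u v : circle R) : val v < val u -> 0 < sin ((val u - val v) / 2) :> R.
  move=> vu; have /andP[u0 u1] := circleP u; have /andP[v0 v1] := circleP v.
  by apply: sin_gt0_pi; apply/andP; split; lra.
case: (ltgtP (val x) (val y)) => // [xy|yx] _; last by apply/negbTE; rewrite -leNgt ltW ?pos.
by rewrite -oppr_gt0 -sinN -mulNr opprB pos.
Qed.

(** The sine depending only on [w] and [w'] enters the product of the two sides squared, so only the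
    signs given by comparing [x] and [y] with [w] and [w'] matter. *)
Lemma cross_lt x y w w' : x <> w -> x <> w' -> y <> w -> y <> w' -> w <> w' ->
  cross x y w w' <-> (val w < val x) (+) (val w' < val x) !=
    (val w < val y) (+) (val w' < val y).
Proof.
move=> xw xw' yw yw' ww; rewrite crossP //.
have ne (u v : circle R) : u <> v -> val u != val v by move=> uv; apply/eqP => /val_inj.
have lt (u v : circle R) : u <> v -> (val v < val u) = ~~ (sin ((val u - val v) / 2) < 0).
  by move=> uv; rewrite sin_half_sub ?ne //; have := ne _ _ uv; case: (ltgtP (val u) (val v)).
have s0 (u v : circle R) : u <> v -> sin ((val u - val v) / 2) != 0 :> R.
  move=> uv; have := ne _ _ uv; case: (ltgtP (val u) (val v)) => // [uv'|vu] _.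
    by rewrite lt_eqF // sin_half_sub ?lt_eqF.
  rewrite -oppr_eq0 -sinN -mulNr opprB lt_eqF // sin_half_sub ?lt_eqF //.
rewrite !lt // !chord_sideE.
have := s0 _ _ xw; have := s0 _ _ xw'; have := s0 _ _ yw; have := s0 _ _ yw'.
have := s0 _ _ (nesym ww).
move: (sin _) (sin _) (sin _) (sin _) (sin _) => a b c d e e0 d0 c0 b0 a0.
have -> : 4 * e * b * a * (4 * e * d * c) = (16 * e ^+ 2) * (a * b * (c * d)) by ring.
have e16 : 0 < 16 * e ^+ 2 by rewrite mulr_gt0 // exprn_even_gt0.
rewrite pmulr_rlt0 //.
have sgM (u v : R) : u != 0 -> v != 0 -> (u * v < 0) = (u < 0) (+) (v < 0).
  move=> u0 v0; case: (ltgtP u 0) u0 => // hu _.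
    by rewrite nmulr_rlt0 //; case: ltgtP v0.
  by rewrite pmulr_rlt0.
rewrite !sgM ?mulf_neq0 //.
by case: (a < 0); case: (b < 0); case: (c < 0); case: (d < 0).
Qed.

End Angles.

(** * The circle and the cactus satisfy the separation conditions *)

Section GapPoints.
Variables (R : realType) (Z : {fset circle R}).
Local Notation X := (circleposet (Zinf Z)).
Implicit Types x y : X.

Definition gap_pt (u v : R) (n : int) : R := (v + u) / 2 + (v - u) / pi * atan n%:~R.

Lemma gap_pt_lt u v n m : u < v -> (gap_pt u v n < gap_pt u v m) = (n < m).
Proof.
move=> uv; have pp := pi_gt0 R.
rewrite /gap_pt ltrD2l ltr_pM2l ?divr_gt0 ?subr_gt0 //.
have mono i j : i < j -> atan i%:~R < atan j%:~R :> R by move=> ij; rewrite lt_atan ?ltr_int.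
case: (ltgtP n m) => [/mono|/mono/ltW|->]; rewrite ?ltxx //.
by rewrite leNgt => /negbTE.
Qed.

Lemma gap_pt_bounds u v n : u < v -> u < gap_pt u v n < v.
Proof.
move=> uv; have pp := pi_gt0 R; rewrite /gap_pt.
have a1 := atan_gtNpi2 (n%:~R : R); have a2 := atan_ltpi2 (n%:~R : R).
set A := atan _ in a1 a2 *.
have -> : (v - u) / pi * A = (v - u) * (A / pi) by rewrite mulrAC mulrA.
have b1 : - (1 / 2) < A / pi by rewrite ltr_pdivlMr //; lra.
have b2 : A / pi < 1 / 2 by rewrite ltr_pdivrMr //; lra.
move: (A / pi) b1 b2 => c b1 b2.
have k1 : 0 < (v - u) * (1 / 2 + c) by rewrite mulr_gt0 ?subr_gt0 //; lra.
have k2 : 0 < (v - u) * (1 / 2 - c) by rewrite mulr_gt0 ?subr_gt0 //; lra.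
by apply/andP; split; lra.
Qed.

Lemma gap_pt_shift u v n s : gap_pt (u + s) (v + s) n = gap_pt u v n + s.
Proof.
rewrite /gap_pt (_ : v + s - (u + s) = v - u); last by ring.
by set w := _ / pi * _; lra.
Qed.

Lemma angle_lift_shift (v : R) (j : int) :
  angle_lift Z v -> angle_lift Z (v + 2 * pi * j%:~R).
Proof.
by move=> [z zZ [m ->]]; exists z => //; exists (m + j); rewrite rmorphD /=; ring.
Qed.

Lemma consecutive_shift (u v : R) (j : int) : consecutive Z u v ->
  consecutive Z (u + 2 * pi * j%:~R) (v + 2 * pi * j%:~R).
Proof.
move=> [lu [lv [uv gap]]]; split; first exact: angle_lift_shift.
split; first exact: angle_lift_shift.
split=> [|w /(angle_lift_shift (- j)) lw /andP[uw wv]]; first by rewrite ltrD2r.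
apply: (gap _ lw); rewrite rmorphN /= mulrN.
by apply/andP; split; rewrite ?ltrBlDr ?ltrBrDr.
Qed.

Lemma consecutive_unique (u v u' v' w : R) :
  consecutive Z u v -> consecutive Z u' v' -> u < w < v -> u' < w < v' ->
  u = u' /\ v = v'.
Proof.
move=> [lu [lv [uv gap]]] [lu' [lv' [uv' gap']]] /andP[uw wv] /andP[uw' wv'].
split; apply/eqP; rewrite eq_le !leNgt; apply/andP; split; apply/negP => h.
- by apply: (gap' _ lu); apply/andP; split; lra.
- by apply: (gap _ lu'); apply/andP; split; lra.
- by apply: (gap _ lv'); apply/andP; split; lra.
- by apply: (gap' _ lv); apply/andP; split; lra.
Qed.

(* The point following the n-th point of a gap is the (n + 1)-st one. *)
Lemma next_point x : exists y, [/\ y <> x,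
  forall w : X, w <> x -> angle (val x) (val y) <= angle (val x) (val w) &
  forall z, z \in Z -> angle (val x) (val y) < angle (val x) z].
Proof.
have pp := pi_gt0 R.
have [u [v [n [m [cuv xE]]]]] : Zinf Z (val x) by exact/set_mem/(valP x).
have [lu [lv [uv gap]]] := cuv.
rewrite -/(gap_pt u v n) in xE.
have vu : v <= u + 2 * pi.
  rewrite leNgt; apply/negP => h; apply: (gap (u + 2 * pi * 1%:~R)).
    exact: angle_lift_shift.
  by rewrite mulr1; apply/andP; split; lra.
have /andP[ux xv] := gap_pt_bounds n uv.
have /andP[uy yv] := gap_pt_bounds (n + 1) uv.
have xy : gap_pt u v n < gap_pt u v (n + 1) by rewrite gap_pt_lt // ltrDl.
set d := gap_pt u v (n + 1) - gap_pt u v n.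
have [y [j yE]] : exists y : circle R, exists j : int,
    val y + 2 * pi * j%:~R = gap_pt u v (n + 1).
  have p2 : 0 < 2 * pi :> R by rewrite mulr_gt0.
  pose j := Num.floor (gap_pt u v (n + 1) / (2 * pi)).
  have b : 0 <= gap_pt u v (n + 1) - 2 * pi * j%:~R < 2 * pi.
    have /andP[] := floor_itv (gap_pt u v (n + 1) / (2 * pi)).
    rewrite -/j ler_pdivlMr // ltr_pdivrMr // rmorphD /= mulrDl mul1r => j1 j2.
    by apply/andP; split; lra.
  by exists (exist (fun a : R => 0 <= a < 2 * pi) _ b), j => /=; rewrite subrK.
have yZ : y \in Zinf Z by apply/mem_set; exists u, v, (n + 1), j.
have d0 : 0 < d by rewrite subr_gt0.
have xyd : angle (val x) y = d.
  apply: (@angle_unique _ _ _ _ (j - m)); first by rewrite /d; apply/andP; split; lra.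
  have -> : val (val x) = gap_pt u v n - 2 * pi * m%:~R by rewrite -xE; ring.
  by rewrite rmorphB /= mulrBr addrA yE /d; ring.
have lift (p : circle R) : exists i : int,
    val p + 2 * pi * i%:~R = gap_pt u v n + angle (val x) p.
  have [i pE] := add_angle (val x) p; exists (i + m).
  transitivity (val p + 2 * pi * i%:~R + 2 * pi * m%:~R).
    by rewrite rmorphD /=; ring.
  by rewrite pE -xE; ring.
pose Y : X := exist _ y yZ; have YE : val Y = y by [].
exists Y; rewrite YE xyd; split=> [Yx|w wx|z zZ].
- have : angle (val x) y = 0 by rewrite -YE Yx angle_ltE ltxx subrr mul0r addr0.
  by rewrite xyd => d00; move: d0; rewrite d00 ltxx.
- rewrite leNgt; apply/negP => wd.
  have w0 : 0 < angle (val x) (val w) by apply: angle_gt0 => /val_inj/esym.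
  have [i wE] := lift (val w).
  have [u' [v' [n' [m' [cuv' wE']]]]] : Zinf Z (val w) by exact/set_mem/(valP w).
  rewrite -/(gap_pt u' v' n') in wE'.
  have [_ [_ [uv' _]]] := cuv'; have /andP[uw wv] := gap_pt_bounds n' uv'.
  (* The point [w] lies strictly inside the gap of [x], so up to [s], a whole number of turns, its
     own gap is the same one; its index would then lie strictly between [n] and [n + 1]. *)
  pose s : R := 2 * pi * (i - m')%:~R.
  have wE2 : val (val w) + 2 * pi * i%:~R = gap_pt u' v' n' + s.
    by rewrite -wE' /s rmorphB /=; ring.
  have [uE vE] : u = u' + s /\ v = v' + s.
    apply: (consecutive_unique cuv (consecutive_shift _ cuv')
      (w := val (val w) + 2 * pi * i%:~R)).
      by rewrite wE; rewrite /d in wd; apply/andP; split; lra.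
    by rewrite wE2 !ltrD2r uw.
  have gE : gap_pt u v n' = gap_pt u' v' n' + s.
    by rewrite uE vE gap_pt_shift.
  have h1 : gap_pt u v n < gap_pt u v n' by rewrite gE -wE2 wE; lra.
  have h2 : gap_pt u v n' < gap_pt u v (n + 1).
    by rewrite gE -wE2 wE; rewrite /d in wd; lra.
  by move: h1 h2; rewrite !gap_pt_lt // ltzD1 ltNge => /negbTE ->.
- rewrite ltNge; apply/negP => zd; have [i zE] := lift z.
  apply: (gap (gap_pt u v n + angle (val x) z)); first by exists z => //; exists i.
  have /andP[a0 _] := angle_bounds (val x) z.
  by rewrite /d in zd; apply/andP; split; lra.
Qed.

Local Notation phi := (@succ_pt R (Zinf Z)).

Lemma succ_ptP x : phi x <> x /\
  forall w : X, w <> x -> angle (val x) (val (phi x)) <= angle (val x) (val w).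
Proof.
have [y [yx ymin _]] := next_point x.
rewrite /succ_pt; case: xgetP => [z _ //|/(_ y)[]].
by split.
Qed.

Lemma succ_pt_gap x z : z \in Z -> angle (val x) (val (phi x)) < angle (val x) z.
Proof.
have [y [yx _ yZ]] := next_point x; have [_ xmin] := succ_ptP x.
by move=> /yZ; apply: le_lt_trans; exact: xmin.
Qed.

Lemma cocycle_lt x y z : (cocycle x y z + (val (val z) < val (val x))%R =
  (val (val y) < val (val x))%R + (val (val z) < val (val y))%R)%N.
Proof. exact: angle_cocycle_lt. Qed.

Lemma val_val_neq x y : x <> y ->
  ((val (val x) < val (val y))%R + (val (val y) < val (val x))%R = 1)%N.
Proof.
move=> xy; have : val (val x) != val (val y) by apply/eqP => /val_inj/val_inj.
by case: ltgtP.
Qed.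

Lemma cocycle_degree x y : x <> y -> cocycle x y x = 1%N.
Proof. by move=> /val_val_neq; have := cocycle_lt x y x; rewrite ltxx; lia. Qed.

Lemma cocycle_rot x y z : z <> x -> z <> y -> cocycle x y z = cocycle z x y.
Proof.
move=> /val_val_neq zx /val_val_neq zy.
by have := cocycle_lt x y z; have := cocycle_lt z x y; lia.
Qed.

Lemma cocycle_angle_eq0 x y z : angle (val x) (val y) + angle (val y) (val z) -
  angle (val x) (val z) < 2 * pi -> cocycle x y z = 0%N.
Proof.
rewrite -angle_cocycleE -[X in _ < X -> _]mul1r ltr_pM2r ?mulr_gt0 ?pi_gt0 //.
by rewrite -[cocycle x y z]/(angle_cocycle _ _ _) ltrn1 ltnS leqn0 => /eqP.
Qed.

Lemma cocycle_succ x y : y <> x -> cocycle x (phi x) y = 0%N.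
Proof.
move=> yx; apply: cocycle_angle_eq0; have [_ /(_ _ yx) le] := succ_ptP x.
by have /andP[_ a1] := angle_bounds (val (phi x)) (val y); lra.
Qed.

Lemma cocycle_to_succ x y : phi y <> x -> cocycle x y (phi y) = 0%N.
Proof.
move=> yx; have [->|xy] := pselect (x = y); first exact: cocyclexxy.
apply: cocycle_angle_eq0; have [_ /(_ _ xy) le] := succ_ptP y.
have ne (u v : X) : u <> v -> val u <> val v by move=> uv /val_inj.
by have := angleC (ne _ _ xy); have := angle_gt0 (ne _ _ (nesym yx)); lra.
Qed.

(** Both sides vanish unless [phi y = x], and then both are loops at [x] through a different
    point. *)
Lemma cocycle_succ_natural x y : cocycle x (phi x) (phi y) = cocycle x y (phi y).
Proof.
have [yx|yx] := pselect (phi y = x); last by rewrite cocycle_succ ?cocycle_to_succ.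
rewrite yx cocycle_degree; last exact/nesym/(succ_ptP x).1.
rewrite cocycle_degree // -yx; exact: (succ_ptP y).1.
Qed.

Variable rho : rel Z.
Local Notation nc := (@rho_noncrossing R Z rho).

Definition below x (z : Z) : bool := val (val z) < val (val x).

(** The parity of the number of ends of a geodesic below a point tells the side on which the point
    lies. *)
Lemma rho_noncrossingP x y : nc x y <-> forall w w' : Z, rho w w' ->
  below x w (+) below x w' = below y w (+) below y w'.
Proof.
have neZ (u : X) (w : Z) : val u <> val w.
  have := Zinf_notin (set_mem (valP u)).
  by move=> /negP uZ e; apply: uZ; rewrite e; exact: valP.
have crossE w w' : w <> w' -> cross (val x) (val y) (val w) (val w') <->
    below x w (+) below x w' != below y w (+) below y w'.
  by move=> ww; apply: cross_lt => // /val_inj.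
split=> [xy w w' ww|xy w w' ww].
  have [->|/eqP wn] := eqVneq w w'; first by rewrite !addbb.
  by apply/eqP/negPn/negP => /(crossE _ _ wn); exact: xy.
have [->|/eqP wn] := eqVneq w w'; first by move=> [p [_ []]].
by move/(crossE _ _ wn); rewrite (xy _ _ ww) eqxx.
Qed.

Lemma rho_noncrossing_sym x y : nc x y -> nc y x.
Proof.
by move=> /rho_noncrossingP xy; apply/rho_noncrossingP => w w' /xy ->.
Qed.

(** No point of [Z] lies between [x] and [phi x]. Comparison with a point of [Z] therefore changes
    for none of them or, when the step passes angle 0, for all; parities over a pair are
    unaffected. *)
Lemma rho_noncrossing_succ x : nc x (phi x).
Proof.
apply/rho_noncrossingP => w w' _.
have H (z : Z) : below x z (+) below (phi x) z = (val (val (phi x)) < val (val x)).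
  have := succ_pt_gap x (valP z); rewrite !angle_ltE /below.
  have := circleP (val z); have := circleP (val (phi x)); have := circleP (val x).
  move: (val (val (phi x))) (val (val x)) (val (val z)) => p a b; move: pi => P.
  move=> /andP[a0 a1] /andP[p0 p1] /andP[b0 b1].
  case: (ltP p a) => pa; case: (ltP b a) => ba; case: (ltP b p) => bp //;
  rewrite ?mul0r ?mul1r => h; exfalso; lra.
move: (H w) (H w'); case: (_ < _); do 4! case: (below _ _); by [].
Qed.

(** The sum of the two comparisons is membership in the half-open interval between [a] and [b], and
    a point outside it compares alike with all points inside. *)
Lemma interval_lt (a b x y v : R) : (a < x) (+) (b < x) -> (a < y) (+) (b < y) ->
  ~~ ((a < v) (+) (b < v)) -> (x < v) = (y < v) /\ (v < x) = (v < y).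
Proof.
wlog ab : a b / a <= b => [H|].
  have [/H//|/ltW ba] := leP a b; rewrite ![(a < _) (+) _]addbC; exact: H.
have inE z : (a < z) (+) (b < z) = (a < z <= b).
  by case: (ltP a z) => az; case: (ltP b z) => bz //; exfalso; lra.
rewrite !inE => /andP[ax xb] /andP[ay yb].
rewrite negb_and -leNgt -ltNge => /orP[va|bv].
  by rewrite !ltNge (ltW (le_lt_trans va ax)) (ltW (le_lt_trans va ay))
    !leNgt (le_lt_trans va ax) (le_lt_trans va ay).
by rewrite (le_lt_trans xb bv) (le_lt_trans yb bv) !ltNge
  (ltW (le_lt_trans xb bv)) (ltW (le_lt_trans yb bv)).
Qed.

(** Some geodesic of [rho] separates [x], [y] from [v], [w]: one pair lies in the interval between
    its ends and the other outside, so the descents in [cocycle_lt] balance. *)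
Lemma rho_noncrossing_const x y v w : nc x y -> nc v w -> ~ nc x v ->
  cocycle v x y = cocycle w x y.
Proof.
move=> /rho_noncrossingP xy /rho_noncrossingP vw xv.
have [a [b [ab sep]]] : exists a b : Z, rho a b /\
    below x a (+) below x b != below v a (+) below v b.
  apply: contrapT => H; apply: xv; apply/rho_noncrossingP => a b ab.
  by apply/eqP/negPn/negP => ne; apply: H; exists a, b.
have {}xy := xy _ _ ab; have {}vw := vw _ _ ab.
have : ((val (val x) < val (val v))%R + (val (val y) < val (val w))%R =
        (val (val x) < val (val w))%R + (val (val y) < val (val v))%R)%N.
  pose I (z : R) := (val (val a) < z) (+) (val (val b) < z).
  have {}sep : I (val (val x)) != I (val (val v)) := sep.
  have {}xy : I (val (val x)) = I (val (val y)) := xy.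
  have {}vw : I (val (val v)) = I (val (val w)) := vw.
  case Ix : (I (val (val x))) sep xy => /eqP Iv Iy.
    have {}Iv : ~~ I (val (val v)) by apply/negP => /esym.
    have [-> _] := interval_lt Ix (esym Iy) Iv; rewrite vw in Iv.
    by have [-> _] := interval_lt Ix (esym Iy) Iv; rewrite addnC.
  have {}Iv : I (val (val v)) by apply/negPn/negP => /negbTE/esym.
  have Iw : I (val (val w)) by rewrite -vw.
  have [_ ->] := interval_lt Iv Iw (negbT Ix).
  by have [_ ->] := interval_lt Iv Iw (negbT (esym Iy)).
move: (cocycle_lt v x y) (cocycle_lt w x y).
have aux (c1 c2 p q l s u : nat) :
    (c1 + s = p + u -> c2 + q = l + u -> p + q = l + s -> c1 = c2)%N by clear; lia.
exact: aux.
Qed.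

Theorem separated_circle : separated phi nc.
Proof.
have ne x y : ~ nc x y -> x <> y.
  by move=> xy E; apply: xy; rewrite E; exact: rho_noncrossingxx.
split.
- exact: rho_noncrossingxx.
- exact: rho_noncrossing_sym.
- exact: rho_noncrossing_trans.
- exact: rho_noncrossing_succ.
- by move=> x; apply: cocycle_degree; exact/nesym/(succ_ptP x).1.
- exact: cocycle_succ_natural.
- by move=> x y _; exact: cocycle_degree.
- by move=> x y _ xy; apply: cocycle_succ; exact: nesym.
- move=> x y xy; apply: cocycle_to_succ => yx; apply: xy.
  by rewrite -yx; apply: rho_noncrossing_sym; exact: rho_noncrossing_succ.
- exact: rho_noncrossing_const.
- move=> x y v xy xv; apply: cocycle_rot; first exact/nesym/ne.
  by move=> vy; apply: xv; rewrite vy.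
Qed.

(** Crossing depends only on classes, so one correction term is zero and the other two cancel. *)
Lemma cactus_near x y z : nc x y \/ nc y z ->
  @cocycle (cactus rho) x y z = cocycle x y z.
Proof.
have xE u v : nc u v -> rho_crossing rho u v = 0%N.
  by move=> uv; rewrite /rho_crossing; case: asboolP.
have bE u u' v v' : (nc u v <-> nc u' v') ->
    rho_crossing rho u v = rho_crossing rho u' v'.
  by move=> uv; rewrite /rho_crossing; congr (~~ _ : nat); exact: asbool_equiv_eq.
have := cactus_cocycleE rho x y z.
rewrite -[cactus_cocycle _ _ _ _]/(@cocycle (cactus rho) x y z).
move=> E [xy|yz].
  have xz : rho_crossing rho x z = rho_crossing rho y z.
    apply: bE; split; last exact: rho_noncrossing_trans.
    exact/rho_noncrossing_trans/rho_noncrossing_sym.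
  by move: E; rewrite (xE _ _ xy) xz; lia.
have xz : rho_crossing rho x z = rho_crossing rho x y.
  apply: bE; split=> [/rho_noncrossing_trans|/rho_noncrossing_trans]; apply=> //.
  exact: rho_noncrossing_sym.
by move: E; rewrite (xE _ _ yz) xz; lia.
Qed.

Theorem separated_cactus : @separated (cactus rho) phi nc.
Proof.
have nr := rho_noncrossing_succ.
case: separated_circle => r s t p d n nd np fp fc fy; split=> //.
- by move=> x; rewrite cactus_near //; left.
- by move=> x y; rewrite !cactus_near //; [right|left].
- by move=> x y xy; rewrite cactus_near; [exact: nd|left].
- by move=> x y xy; rewrite cactus_near; [exact: np|left].
- by move=> x y xy; rewrite cactus_near; [exact: fp|right].
- by move=> x y v w xy vw xv; rewrite !cactus_near; [exact: fc|right|right].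
- by move=> x y v xy xv; rewrite !cactus_near; [exact: fy|right|left].
Qed.

Lemma cactus_edata (k : fieldType) (E : edata k (cactus rho)) : nc (ex E) (ey E).
Proof.
apply: contrapT => xy; set c := @cocycle (cactus rho) (ex E) (ey E) (ex E).
have c3 : c = 3%N.
  have cr u v : ~ nc u v -> rho_crossing rho u v = 1%N.
    by move=> uv; rewrite /rho_crossing; case: asboolP.
  have := cactus_cocycleE rho (ex E) (ey E) (ex E).
  rewrite -[cactus_cocycle _ _ _ _]/c (cr (ex E) (ey E)) // (cr (ey E) (ex E)).
    rewrite cocycle_degree => [|xE]; last first.
      by apply: xy; rewrite -xE; exact: rho_noncrossingxx.
    by rewrite /rho_crossing; case: asboolP => [_|[]]; [lia|exact: rho_noncrossingxx].
  by move=> /rho_noncrossing_sym.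
have : ebeta E * ealpha E * fps_t ^+ c = fps_t * 1 :> fps k := ebetaalpha E.
rewrite c3 exprS mulrCA => /fps_t_lreg; rewrite exprS mulrCA.
exact: fps_t_nonunit.
Qed.

Lemma below_near x y : [ffun z => below x z] = [ffun z => below y z] -> nc x y.
Proof.
move=> /ffunP E; apply/rho_noncrossingP => w w' _.
by have := E w; have := E w'; rewrite !ffunE => -> ->.
Qed.

End GapPoints.

(** * Conclusion *)

Lemma fullcat_all (A : comNzRingType) (C : lincat A) (P : ob C -> Prop) :
  (forall x, P x) -> lincat_iso (@fullcat A C {x | P x} (@proj1_sig _ _)) C.
Proof.
move=> allP; exists (@LinFunctor A (fullcat (@proj1_sig _ _)) C (@proj1_sig _ P)
  (fun x y f => f) (fun x => erefl) (fun x y z g f => erefl) (fun x y a f f' => erefl)).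
split; last by move=> x y; exists id.
exists (fun x => exist _ x (allP x)) => [[x Px]|x] //=.
exact: eq_exist.
Qed.

(** The categories are equal, not merely isomorphic, since the cyclic posets differ only in proofs
    once the cocycles are identified. *)
Lemma Ccan_cocycle (k : fieldType) (T : Type) (c c' : T -> T -> T -> nat)
    h1 h2 h3 h1' h2' h3' (phi : T -> T) :
  (forall x y z, c x y z = c' x y z) ->
  @Ccan k (@CyclicPoset T c h1 h2 h3) phi = @Ccan k (@CyclicPoset T c' h1' h2' h3') phi.
Proof.
move=> cc'; have {}cc' : c = c' by apply/funext => x; apply/funext => y; apply/funext.
subst c'.
by rewrite (Prop_irrelevance h1' h1) (Prop_irrelevance h2' h2) (Prop_irrelevance h3' h3).
Qed.

Theorem theorem4p36 (R : realType) (k : fieldType) (Z : {fset circle R})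
    (rho : rel Z) (rhoE : equivalence_rel rho) (rhoN : noncrossing_rel rho) :
  lincat_iso
    (@Ccan k (cactus rho) (@succ_pt R (Zinf Z)))
    (Ccan_rho rho k)
  /\
  lincat_iso
    (Ccan_rho rho k)
    (prodcat (fun V : rho_class rho =>
       @Ccan k (subposet (sval V)) (subauto (@succ_pt R (Zinf Z)) (V := sval V)))).
Proof.
have circle_iso := near_objects_iso k (separated_circle rho) (@below_near _ _ rho).
have cactus_iso := near_objects_iso k (separated_cactus rho) (@below_near _ _ rho).
have prodE : prodcat (fun V : rho_class rho =>
      @Ccan k (@subposet (cactus rho) (sval V))
        (subauto (X := cactus rho) (@succ_pt R (Zinf Z)) (V := sval V))) =
    prodcat (fun V : rho_class rho =>
      @Ccan k (subposet (sval V)) (subauto (@succ_pt R (Zinf Z)) (V := sval V))).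
  congr prodcat; apply/funext => V; apply: Ccan_cocycle => x y z.
  apply: cactus_near; left.
  by apply/(point_classP (separated_circle rho));
    rewrite !(subposet_class (separated_circle rho)).
split; last exact: circle_iso.
apply: lincat_iso_trans (lincat_iso_sym circle_iso).
rewrite -prodE; apply: lincat_iso_trans cactus_iso.
(* Every object of the cactus category has its summands inside classes, so its subcategory of such
   objects is everything. *)
apply/lincat_iso_sym/fullcat_all => M E _; exact: cactus_edata.
Qed.
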